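(* There is a constant $C$ such that for every integer $N \ge 2$ there exists a partially restricted glue tile assembly system (prgTAS) $\mathcal{T}_N = (T_N, \sigma, 1)$ with $|T_N| \le C\log N$ such that, for every value $-m$ ($m \ge 1$) of the strength of its unique negative glue, $\mathcal{T}_N$ is directed and the square $S_N = \{0,1,\ldots,N-1\} \times \{0,1,\ldots,N-1\}$ strictly self-assembles in $\mathcal{T}_N$.
   Context: Abstract Tile Assembly Model (aTAM) in $\mathbb{Z}^2$. A tile type is a unit square that can be translated but not rotated; each of its four sides carries a glue, consisting of a label from a fixed alphabet and an integer strength. Two tiles at adjacent positions interact with strength $s$ iff the glues on their abutting sides have the same label and strength $s$; otherwise they interact with strength $0$. An assembly is a partial function $\alpha:\mathbb{Z}^2 \rightharpoonup T$. A TAS is a triple $(T,\sigma,\tau)$ with finite tile set $T$, finite seed assembly $\sigma$ (here a single tile), temperature $\tau$. Growth is irreversible: starting from $\sigma$, tiles are added one at a time; a tile may be placed at an empty position iff the sum of its interaction strengths (positive and negative) with the tiles already at neighboring positions is at least $\tau$; placed tiles never detach. An assembly is terminal if no tile can be added; the TAS is directed if it has exactly one terminal assembly. A set $X$ strictly self-assembles if every terminal assembly has domain exactly $X$. A TAS $(T,\sigma,1)$ is partially glue restricted (prgTAS) if (1) every positive glue strength is $1$, (2) the glue function is diagonal (a glue interacts only with an identical glue), and (3) there is exactly one glue type of negative strength, whose strength is only guaranteed to be some integer $\le -1$ (it may be $-1,-2,-3,\ldots$). Logarithms are base 2. *)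

(* Defs.v *)
From Stdlib Require Import ZArith List Reals.
Open Scope Z_scope.

(** Glues of a partially glue restricted TAS.  [NullG] is the null glue
    (strength 0, interacts with nothing); [PosG l] is the glue with label [l]
    and strength 1; [NegG] is the unique glue type of negative strength.
    Glue interaction is diagonal: only identical glues interact. *)
Inductive glue : Type := NullG | PosG (l : nat) | NegG.

Record tile : Type := mkTile { gN : glue; gE : glue; gS : glue; gW : glue }.

Definition position : Type := (Z * Z)%type.

Definition assembly : Type := position -> option tile.

Definition gstr (m : Z) (a b : glue) : Z :=
  match a, b with
  | PosG x, PosG y => if Nat.eqb x y then 1 else 0
  | NegG, NegG => - m
  | _, _ => 0
  end.

Definition side_str (m : Z) (g : glue) (o : option tile) (opp : tile -> glue) : Z :=
  match o with Some u => gstr m g (opp u) | None => 0 end.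

Definition nb_str (m : Z) (a : assembly) (p : position) (t : tile) : Z :=
  let (x, y) := p in
    side_str m (gN t) (a (x, y + 1)) gS
  + side_str m (gE t) (a (x + 1, y)) gW
  + side_str m (gS t) (a (x, y - 1)) gN
  + side_str m (gW t) (a (x - 1, y)) gE.

Definition pos_eqb (p q : position) : bool :=
  Z.eqb (fst p) (fst q) && Z.eqb (snd p) (snd q).

(** Temperature 1: a tile of [T] may attach at an empty position iff the total
    interaction strength is at least 1. *)
Definition attachable (T : list tile) (m : Z) (a : assembly) (p : position) (t : tile) : Prop :=
  In t T /\ a p = None /\ 1 <= nb_str m a p t.

Definition add_tile (a : assembly) (p : position) (t : tile) : assembly :=
  fun q => if pos_eqb q p then Some t else a q.

(** One step of (irreversible) growth, possibly a stutter step. *)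
Definition step (T : list tile) (m : Z) (a b : assembly) : Prop :=
  (forall q, b q = a q) \/
  exists p t, attachable T m a p t /\ forall q, b q = add_tile a p t q.

Definition seed_asm (p0 : position) (s : tile) : assembly :=
  fun q => if pos_eqb q p0 then Some s else None.

(** Producible assemblies: results (pointwise limits) of finite or infinite
    assembly sequences starting from the single-tile seed [s] at [p0]. *)
Definition producible (T : list tile) (m : Z) (p0 : position) (s : tile) (al : assembly) : Prop :=
  exists sq : nat -> assembly,
    (forall q, sq O q = seed_asm p0 s q) /\
    (forall i, step T m (sq i) (sq (S i))) /\
    (forall q t, al q = Some t <-> exists i, sq i q = Some t).

Definition terminal (T : list tile) (m : Z) (p0 : position) (s : tile) (al : assembly) : Prop :=
  producible T m p0 s al /\ forall p t, ~ attachable T m al p t.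

Definition directed (T : list tile) (m : Z) (p0 : position) (s : tile) : Prop :=
  (exists al, terminal T m p0 s al) /\
  (forall al be, terminal T m p0 s al -> terminal T m p0 s be -> forall q, al q = be q).

Definition strictly_self_assembles (T : list tile) (m : Z) (p0 : position) (s : tile)
    (X : position -> Prop) : Prop :=
  forall al, terminal T m p0 s al -> forall q, (al q <> None <-> X q).

(** prgTAS tile set: a finite set (duplicate-free list) of tile types
    containing the seed tile, in which the (unique) negative glue type
    actually occurs. Conditions (1),(2),(3) are built into [glue]/[gstr]. *)
Definition uses_neg (t : tile) : Prop :=
  gN t = NegG \/ gE t = NegG \/ gS t = NegG \/ gW t = NegG.

Definition prg_tileset (T : list tile) (s : tile) : Prop :=
  NoDup T /\ In s T /\ exists t, In t T /\ uses_neg t.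

Definition square (N : Z) (q : position) : Prop :=
  0 <= fst q < N /\ 0 <= snd q < N.

Definition log2R (x : R) : R := (ln x / ln 2)%R.

(* Main.v *)
Require Import Defs.
From Stdlib Require Import ZArith List Reals.
From Stdlib Require Import Bool Cantor FinFun Lia Lra Classical.

(** At temperature 1 a tile attaches through a single positive glue, so the
    assembly is a tree grown from the seed; the negative glue serves only to
    forbid an attachment.  A bit is stored as a repelling side at one of two
    places of a row.  The path above it forks towards both places with tiles whose
    lower side repels: exactly one of them fits, and it fills the place of the
    other one from the side.  Thus a path can read a row of bits and write another
    row on top of its own, and O(k) tile types suffice for a k-bit counter that
    alternates incrementing rightward passes and copying leftward passes, until
    the increment overflows.  Such a counter fills a strip.  Four rotated strips
    surround the square like a pinwheel, each one starting where the previous one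
    ends, and the last strip emits columns of a single filler tile that stop at
    the second strip.  The strength of the negative glue does not matter, since an
    unintended tile always meets one positive bond and at least one repulsion.
    Small squares are assembled from one tile type per position. *)

(** The strength of a repulsion is irrelevant, but its timing is not. Placed tiles never detach, so
    a repelling side that arrives after the tile it should forbid is useless. Hence wherever a glue
    is offered to a tile that does not belong, the obstacle (a repelling neighbour, or a tile
    already filling the place) has to be an ancestor of the offering tile in the tree of growth.
    Most of the work on strips establishes such ancestor relations.

    A counting cell has five columns: one to climb, two to read and two to write. Leftward cells are
    mirrored and shifted by one column so that the two columns written by one pass lie exactly under
    the two columns read by the next. The copying pass is the way back of the path: carries travel
    rightward only, and the bits have to be carried up to the new top row. *)

#[local] Arguments Z.mul : simpl never.
#[local] Arguments Z.add : simpl never.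
#[local] Arguments Z.sub : simpl never.

(** * Tree-like assemblies *)

Inductive dir : Type := DN | DE | DS | DW.

Definition opp (d : dir) : dir :=
  match d with DN => DS | DE => DW | DS => DN | DW => DE end.

Definition dir_eqb (d e : dir) : bool :=
  match d, e with
  | DN, DN | DE, DE | DS, DS | DW, DW => true
  | _, _ => false
  end.

Definition move (p : position) (d : dir) : position :=
  match d with
  | DN => (fst p, snd p + 1)
  | DE => (fst p + 1, snd p)
  | DS => (fst p, snd p - 1)
  | DW => (fst p - 1, snd p)
  end.

Lemma opp_involutive (d : dir) : opp (opp d) = d.
Proof. now destruct d. Qed.

Lemma dir_eqb_spec (d e : dir) : reflect (d = e) (dir_eqb d e).
Proof. now destruct d, e; constructor. Qed.

Lemma move_opp (p : position) (d : dir) : move (move p d) (opp d) = p.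
Proof. destruct p, d; simpl; f_equal; lia. Qed.

Lemma move_opp_l (p : position) (d : dir) : move (move p (opp d)) d = p.
Proof. rewrite <- (opp_involutive d) at 2. apply move_opp. Qed.

Inductive face (A : Type) : Type := Blank | Repel | Emit (a : A).
Arguments Blank {A}.
Arguments Repel {A}.
Arguments Emit {A} a.

(** Every tile type is named by the label of the only glue through which it can
    be attached; [arrival] is the direction in which growth enters the tile and
    [faces] describes the three remaining sides. *)
Record blueprint : Type := {
  label : Type;
  code : label -> nat;
  arrival : label -> dir;
  faces : label -> dir -> face label;
  labels : list label;
  layout : position -> option label;
  root : position
}.

Section Blueprint.
Context (B : blueprint).

Definition side_glue (l : label B) (d : dir) : glue :=
  if dir_eqb (arrival B l) (opp d) then PosG (code B l)
  else match faces B l d with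
       | Blank => NullG
       | Repel => NegG
       | Emit l' => PosG (code B l')
       end.

Definition tile_of (l : label B) : tile :=
  mkTile (side_glue l DN) (side_glue l DE) (side_glue l DS) (side_glue l DW).

Definition target (p : position) : option tile :=
  option_map tile_of (layout B p).

(** [before q p]: the growth path from the root to [p] runs through [q]. *)
Inductive before (q : position) : position -> Prop :=
| before_refl : before q q
| before_step p l : layout B p = Some l -> p <> root B ->
    before q (move p (opp (arrival B l))) -> before q p.

(** [emission] tells why a glue offered in the wrong place is harmless: the place is filled by an
    ancestor, or an ancestor repels the newcomer. [repulsion] concerns the finished layout, so a
    tile that belongs is never rejected, in whatever order its neighbours come. [root_orphan] keeps
    the root from being mistaken for a child, and [face_arrival] ensures that the arrival glue hides
    no face. *)
Record sound : Prop := {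
  code_inj : forall l l', code B l = code B l' -> l = l';
  listed : forall p l, layout B p = Some l -> In l (labels B);
  bounded : exists D, forall p l, layout B p = Some l -> In p D;
  rooted : layout B (root B) <> None;
  root_orphan : forall l d l0, layout B (root B) = Some l0 -> faces B l d <> Emit l0;
  face_arrival : forall l d, faces B l d <> Blank -> arrival B l <> opp d;
  emit_arrival : forall l d l', faces B l d = Emit l' -> arrival B l' = d;
  parent : forall p l, layout B p = Some l -> p <> root B ->
    exists l', layout B (move p (opp (arrival B l))) = Some l' /\
               faces B l' (arrival B l) = Emit l;
  emission : forall q lq d l, layout B q = Some lq -> faces B lq d = Emit l ->
    layout B (move q d) = Some l \/
    before (move q d) q \/
    exists e lr, before (move (move q d) e) q /\
      layout B (move (move q d) e) = Some lr /\
      faces B lr (opp e) = Repel /\ faces B l e = Repel;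
  repulsion : forall p d l l', layout B p = Some l ->
    layout B (move p d) = Some l' ->
    faces B l d = Repel -> faces B l' (opp d) = Repel -> False;
  connected : forall p l, layout B p = Some l -> before (root B) p
}.

(** * Forces between a tile and its neighbours *)

Definition tile_side (t : tile) (d : dir) : glue :=
  match d with DN => gN t | DE => gE t | DS => gS t | DW => gW t end.

Lemma tile_side_of (l : label B) (d : dir) : tile_side (tile_of l) d = side_glue l d.
Proof. now destruct d. Qed.

Definition pull (m : Z) (a : assembly) (p : position) (t : tile) (d : dir) : Z :=
  side_str m (tile_side t d) (a (move p d)) (fun u => tile_side u (opp d)).

Lemma nb_str_pull (m : Z) (a : assembly) (p : position) (t : tile) :
  nb_str m a p t = pull m a p t DN + pull m a p t DE + pull m a p t DS + pull m a p t DW.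
Proof. now destruct p. Qed.

Lemma gstr_pos (m : Z) (g h : glue) : 1 <= m -> 0 < gstr m g h ->
  exists x, g = PosG x /\ h = PosG x.
Proof.
  intros Hm. destruct g as [|x|], h as [|y|]; simpl; try lia.
  destruct (Nat.eqb_spec x y); [subst; eauto | lia].
Qed.

Lemma gstr_le_1 (m : Z) (g h : glue) : 1 <= m -> gstr m g h <= 1.
Proof.
  intros Hm. destruct g as [|x|], h as [|y|]; simpl; try lia.
  destruct (Nat.eqb x y); lia.
Qed.

Lemma gstr_neg (m : Z) (g h : glue) : gstr m g h < 0 -> g = NegG /\ h = NegG.
Proof.
  destruct g as [|x|], h as [|y|]; simpl; try lia; auto.
  destruct (Nat.eqb x y); lia.
Qed.

Context (HB : sound).

Lemma side_glue_arrival (l : label B) : side_glue l (opp (arrival B l)) = PosG (code B l).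
Proof.
  unfold side_glue. rewrite opp_involutive.
  now destruct (dir_eqb_spec (arrival B l) (arrival B l)).
Qed.

Lemma side_glue_face (l : label B) (d : dir) : faces B l d <> Blank ->
  side_glue l d = match faces B l d with
                  | Blank => NullG | Repel => NegG | Emit l' => PosG (code B l') end.
Proof.
  intros H. unfold side_glue.
  destruct (dir_eqb_spec (arrival B l) (opp d)) as [E|E]; auto.
  now apply face_arrival in E.
Qed.

Lemma side_glue_pos (l l' : label B) (d : dir) : side_glue l d = PosG (code B l') ->
  (l = l' /\ arrival B l = opp d) \/ faces B l d = Emit l'.
Proof.
  unfold side_glue.
  destruct (dir_eqb_spec (arrival B l) (opp d)) as [E|E].
  - intros H. injection H as H. apply (code_inj HB) in H. auto.
  - destruct (faces B l d) as [| |l'']; try discriminate.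
    intros H. injection H as H. apply (code_inj HB) in H. subst. auto.
Qed.

Lemma side_glue_neg (l : label B) (d : dir) : side_glue l d = NegG -> faces B l d = Repel.
Proof.
  unfold side_glue. destruct (dir_eqb _ _); try discriminate.
  now destruct (faces B l d).
Qed.

Lemma tile_of_inj (l l' : label B) : tile_of l = tile_of l' -> l = l'.
Proof.
  intros E. pose proof (side_glue_arrival l) as H.
  rewrite <- tile_side_of, E, tile_side_of in H.
  apply side_glue_pos in H. destruct H as [[H _]|H]; auto.
  apply (emit_arrival HB) in H. now destruct (arrival B l).
Qed.

(** The invariant of growth. Closure under parents is what puts every ancestor, and so every needed
    obstacle, in place. *)
Record faithful (a : assembly) : Prop := {
  faithful_sub : forall q t, a q = Some t -> target q = Some t;
  faithful_closed : forall p l, layout B p = Some l -> p <> root B ->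
    a p <> None -> a (move p (opp (arrival B l))) <> None
}.

Lemma faithful_before (a : assembly) (q p : position) :
  faithful a -> before q p -> a p <> None -> a q <> None.
Proof.
  intros Ha Hb. induction Hb as [|p l Hl Hp _ IH]; auto.
  intros H. apply IH. now apply (faithful_closed a Ha p l).
Qed.

Lemma faithful_label (a : assembly) (q : position) (t : tile) :
  faithful a -> a q = Some t -> exists l, layout B q = Some l /\ t = tile_of l.
Proof.
  intros Ha H. apply (faithful_sub a Ha) in H. unfold target in H.
  destruct (layout B q) as [l|]; try discriminate. injection H as H. eauto.
Qed.

(* A positive bond on another side than the arrival side would be with a child
   of [p], which cannot be present while [p] is empty. *)
Lemma pull_nonpos (m : Z) (a : assembly) (p : position) (l : label B) (d : dir) :
  1 <= m -> faithful a -> a p = None -> arrival B l <> opp d ->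
  pull m a p (tile_of l) d <= 0.
Proof.
  intros Hm Ha Hp Hd. unfold pull, side_str.
  destruct (a (move p d)) as [u|] eqn:Hu; [|lia].
  apply Z.le_ngt. intros Hpos.
  destruct (faithful_label a _ u Ha Hu) as (lq & Hlq & ->).
  apply gstr_pos in Hpos; [|lia]. destruct Hpos as (x & H1 & H2).
  rewrite tile_side_of in H1, H2.
  unfold side_glue in H1.
  destruct (dir_eqb_spec (arrival B l) (opp d)) as [E|_]; [easy|].
  destruct (faces B l d) as [| |l'] eqn:Hf; try discriminate.
  injection H1 as <-.
  pose proof (emit_arrival HB _ _ _ Hf) as Hdir.
  apply side_glue_pos in H2. rewrite opp_involutive in H2.
  destruct H2 as [[-> E]|E].
  - assert (Hroot : move p d <> root B)
      by (intros Er; rewrite Er in Hlq; now apply (root_orphan HB l d l' Hlq)).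
    apply (faithful_closed a Ha _ _ Hlq Hroot); [now rewrite Hu|].
    now rewrite E, move_opp.
  - apply (emit_arrival HB) in E. rewrite E in Hdir. now destruct d.
Qed.

(** Only the arrival side can attract, and with strength at most 1, so there is no slack: one
    repulsion of any strength already brings the sum down to 0 or less. This excludes the third case
    of [emission]; in the second the place is not empty. *)
Lemma attachment_faithful (m : Z) (a : assembly) (p : position) (l : label B) :
  1 <= m -> faithful a -> a p = None -> 1 <= nb_str m a p (tile_of l) ->
  layout B p = Some l /\ a (move p (opp (arrival B l))) <> None.
Proof.
  intros Hm Ha Hp Hstr. rewrite nb_str_pull in Hstr.
  pose proof (fun d => pull_nonpos m a p l d Hm Ha Hp) as Hnon.
  set (d0 := opp (arrival B l)).
  assert (Hpull : 0 < pull m a p (tile_of l) d0).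
  { apply Z.nle_gt. intros Hle.
    assert (forall d, pull m a p (tile_of l) d <= 0) as Hall.
    { intros d. destruct (dir_eqb_spec (arrival B l) (opp d)) as [E|E]; auto.
      unfold d0 in Hle. rewrite E, opp_involutive in Hle. auto. }
    pose proof (Hall DN); pose proof (Hall DE); pose proof (Hall DS); pose proof (Hall DW).
    lia. }
  assert (Hle1 : pull m a p (tile_of l) d0 <= 1).
  { unfold pull, side_str. destruct (a (move p d0)); [now apply gstr_le_1 | lia]. }
  unfold pull, side_str in Hpull.
  destruct (a (move p d0)) as [u|] eqn:Hu; [|lia].
  split; [|discriminate].
  destruct (faithful_label a _ u Ha Hu) as (lq & Hlq & ->).
  apply gstr_pos in Hpull; [|lia]. destruct Hpull as (x & H1 & H2).
  rewrite tile_side_of in H1, H2. unfold d0 in H1, H2.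
  rewrite side_glue_arrival in H1. injection H1 as <-.
  rewrite opp_involutive in H2.
  apply side_glue_pos in H2. destruct H2 as [[-> E]|E].
  { now destruct (arrival B l). }
  assert (Hmove : move (move p d0) (arrival B l) = p) by apply move_opp_l.
  destruct (emission HB _ _ _ _ Hlq E) as [H|[H|(e & lr & H & Hlr & Hr & Hl)]];
    rewrite Hmove in *; auto.
  - exfalso. apply (faithful_before a _ _ Ha H); auto. now rewrite Hu.
  - exfalso.
    assert (Hplaced : a (move p e) <> None)
      by (apply (faithful_before a _ _ Ha H); now rewrite Hu).
    assert (He : pull m a p (tile_of l) e = - m).
    { unfold pull, side_str. destruct (a (move p e)) as [v|] eqn:Hv; [|easy].
      destruct (faithful_label a _ v Ha Hv) as (lv & Hlv & ->).
      rewrite Hlr in Hlv. injection Hlv as <-.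
      rewrite !tile_side_of, !side_glue_face, Hr, Hl; try congruence. reflexivity. }
    assert (Hne : arrival B l <> opp e) by (apply (face_arrival HB); congruence).
    pose proof (Hnon DN); pose proof (Hnon DE); pose proof (Hnon DS); pose proof (Hnon DW).
    unfold d0 in Hle1.
    destruct (arrival B l), e; simpl in *; try congruence;
      repeat match goal with
      | X : _ <> _ -> _ |- _ => first [specialize (X ltac:(discriminate)) | clear X]
      end; lia.
Qed.

Lemma attachable_target (m : Z) (a : assembly) (p : position) (l : label B) :
  1 <= m -> faithful a -> layout B p = Some l -> p <> root B -> a p = None ->
  a (move p (opp (arrival B l))) <> None ->
  attachable (map tile_of (labels B)) m a p (tile_of l).
Proof.
  intros Hm Ha Hl Hp Hnone Hpar. split; [|split]; auto.
  { apply in_map. eapply listed; eauto. }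
  rewrite nb_str_pull.
  assert (Hnn : forall d, 0 <= pull m a p (tile_of l) d).
  { intros d. unfold pull, side_str.
    destruct (a (move p d)) as [u|] eqn:Hu; [|lia].
    destruct (faithful_label a _ u Ha Hu) as (lu & Hlu & ->).
    apply Z.nlt_ge. intros Hneg. apply gstr_neg in Hneg.
    rewrite !tile_side_of in Hneg. destruct Hneg as [H1 H2].
    apply side_glue_neg in H1, H2.
    now apply (repulsion HB p d l lu). }
  assert (H1 : pull m a p (tile_of l) (opp (arrival B l)) = 1).
  { unfold pull, side_str.
    destruct (a (move p (opp (arrival B l)))) as [u|] eqn:Hu; [|easy].
    destruct (faithful_label a _ u Ha Hu) as (lu & Hlu & ->).
    destruct (parent HB p l Hl Hp) as (l' & Hl' & Hem).
    rewrite Hl' in Hlu. injection Hlu as ->.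
    rewrite !tile_side_of, side_glue_arrival, opp_involutive, side_glue_face, Hem
      by congruence.
    simpl. now rewrite Nat.eqb_refl. }
  pose proof (Hnn DN); pose proof (Hnn DE); pose proof (Hnn DS); pose proof (Hnn DW).
  destruct (arrival B l); simpl in *; lia.
Qed.

Definition seed_tile : tile :=
  match layout B (root B) with
  | Some l => tile_of l
  | None => mkTile NullG NullG NullG NullG
  end.

Lemma target_root : target (root B) = Some seed_tile.
Proof.
  unfold target, seed_tile. pose proof (rooted HB).
  now destruct (layout B (root B)).
Qed.

Lemma pos_eqb_spec (p q : position) : reflect (p = q) (pos_eqb p q).
Proof.
  destruct p as [x y], q as [x' y']. unfold pos_eqb; simpl.
  destruct (Z.eqb_spec x x'), (Z.eqb_spec y y'); constructor; congruence.
Qed.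

Lemma faithful_ext (a b : assembly) : (forall q, b q = a q) -> faithful a -> faithful b.
Proof.
  intros E [H1 H2]. split.
  - intros q t. rewrite E. auto.
  - intros p l. rewrite !E. auto.
Qed.

Lemma faithful_seed : faithful (seed_asm (root B) seed_tile).
Proof.
  unfold seed_asm. split.
  - intros q t. destruct (pos_eqb_spec q (root B)) as [->|]; [|discriminate].
    intros [= <-]. apply target_root.
  - intros p l _ Hp. now destruct (pos_eqb_spec p (root B)).
Qed.

Lemma faithful_step (m : Z) (a b : assembly) :
  1 <= m -> faithful a -> step (map tile_of (labels B)) m a b -> faithful b.
Proof.
  intros Hm Ha [E|(p & t & (Hin & Hnone & Hstr) & E)].
  - eapply faithful_ext; eauto.
  - apply in_map_iff in Hin. destruct Hin as (l & <- & _).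
    destruct (attachment_faithful m a p l Hm Ha Hnone Hstr) as [Hl Hpar].
    apply (faithful_ext (add_tile a p (tile_of l))); auto.
    unfold add_tile. split.
    + intros q t. destruct (pos_eqb_spec q p) as [->|]; [|apply Ha].
      intros [= <-]. unfold target. now rewrite Hl.
    + intros q lq Hlq Hq Hsome.
      destruct (pos_eqb_spec (move q (opp (arrival B lq))) p) as [_|_]; [easy|].
      destruct (pos_eqb_spec q p) as [->|]; [congruence|].
      now apply (faithful_closed a Ha).
Qed.

Lemma step_mono (T : list tile) (m : Z) (a b : assembly) (q : position) (t : tile) :
  step T m a b -> a q = Some t -> b q = Some t.
Proof.
  intros [E|(p & u & (_ & Hnone & _) & E)] H; rewrite E; auto.
  unfold add_tile. destruct (pos_eqb_spec q p); congruence.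
Qed.

Lemma steps_mono (T : list tile) (m : Z) (sq : nat -> assembly) (i j : nat)
  (q : position) (t : tile) :
  (forall i, step T m (sq i) (sq (S i))) -> (i <= j)%nat ->
  sq i q = Some t -> sq j q = Some t.
Proof.
  intros Hs Hij H. induction Hij; auto. eapply step_mono; eauto.
Qed.

Lemma faithful_producible (m : Z) (al : assembly) : 1 <= m ->
  producible (map tile_of (labels B)) m (root B) seed_tile al ->
  faithful al /\ al (root B) <> None.
Proof.
  intros Hm (sq & H0 & Hs & Hlim).
  assert (Hsq : forall i, faithful (sq i)).
  { induction i.
    - eapply faithful_ext; [exact H0 | apply faithful_seed].
    - eapply faithful_step; eauto. }
  split; [split|].
  - intros q t H. apply Hlim in H. destruct H as [i H]. now apply (Hsq i).
  - intros p l Hl Hp H.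
    destruct (al p) as [t|] eqn:Ht; [|easy].
    apply Hlim in Ht. destruct Ht as [i Ht].
    destruct (sq i (move p (opp (arrival B l)))) as [u|] eqn:Hu.
    + rewrite (proj2 (Hlim _ u)); eauto; discriminate.
    + exfalso. revert Hu. apply (faithful_closed _ (Hsq i)); auto. now rewrite Ht.
  - rewrite (proj2 (Hlim (root B) seed_tile)); [discriminate|].
    exists O. rewrite H0. unfold seed_asm. now destruct (pos_eqb_spec (root B) (root B)).
Qed.

Lemma stuck_complete (m : Z) (al : assembly) : 1 <= m ->
  faithful al -> al (root B) <> None ->
  (forall p t, ~ attachable (map tile_of (labels B)) m al p t) ->
  forall q, al q = target q.
Proof.
  intros Hm Ha Hroot Hstuck q.
  assert (Hfull : forall p, before (root B) p -> al p <> None).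
  { intros p Hb. induction Hb as [|p l Hl Hp _ IH]; auto.
    intros Hnone. apply (Hstuck p (tile_of l)). now apply attachable_target. }
  destruct (al q) as [t|] eqn:Hq.
  - symmetry. now apply (faithful_sub al Ha).
  - unfold target. destruct (layout B q) as [l|] eqn:Hl; auto.
    exfalso. apply (Hfull q); auto. eapply connected; eauto.
Qed.

(** A finite run is an infinite sequence that stutters from some index on: it is producible as it
    stands and can still be prolonged by a tile. *)
Definition reached (m : Z) (a : assembly) : Prop :=
  exists (sq : nat -> assembly) (n : nat),
    (forall q, sq O q = seed_asm (root B) seed_tile q) /\
    (forall i, step (map tile_of (labels B)) m (sq i) (sq (S i))) /\
    (forall i, (n <= i)%nat -> sq i = a).

Lemma reached_producible (m : Z) (a : assembly) : reached m a ->
  producible (map tile_of (labels B)) m (root B) seed_tile a.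
Proof.
  intros (sq & n & H0 & Hs & Hn). exists sq. split; [|split]; auto.
  intros q t. split.
  - intros H. exists n. now rewrite Hn.
  - intros (i & H). rewrite <- (Hn (max i n)) by lia.
    apply (steps_mono _ m sq i (max i n) q t Hs); auto. lia.
Qed.

Lemma reached_add (m : Z) (a : assembly) (p : position) (t : tile) :
  reached m a -> attachable (map tile_of (labels B)) m a p t ->
  reached m (add_tile a p t).
Proof.
  intros (sq & n & H0 & Hs & Hn) Hat.
  exists (fun i => if Nat.leb i n then sq i else add_tile a p t), (S n).
  split; [|split].
  - exact H0.
  - intros i. destruct (Nat.leb_spec i n), (Nat.leb_spec (S i) n); try lia.
    + apply Hs.
    + right. exists p, t. rewrite Hn by lia. auto.
    + now left.
  - intros i Hi. destruct (Nat.leb_spec i n); [lia | auto].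
Qed.

Definition missing (D : list position) (a : assembly) : nat :=
  length (filter (fun p => match a p with None => true | _ => false end) D).

Lemma missing_add_le (D : list position) (a : assembly) (p : position) (t : tile) :
  (missing D (add_tile a p t) <= missing D a)%nat.
Proof.
  unfold missing. induction D as [|x D IH]; simpl; [lia|].
  assert (E : add_tile a p t x = if pos_eqb x p then Some t else a x) by reflexivity.
  rewrite E. destruct (pos_eqb x p), (a x); simpl; lia.
Qed.

Lemma missing_add_lt (D : list position) (a : assembly) (p : position) (t : tile) :
  In p D -> a p = None -> (missing D (add_tile a p t) < missing D a)%nat.
Proof.
  intros HD Hp. induction D as [|x D IH]; [easy|].
  pose proof (missing_add_le D a p t) as Hle. unfold missing in *. simpl.
  assert (E : add_tile a p t x = if pos_eqb x p then Some t else a x) by reflexivity.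
  rewrite E. destruct HD as [->|HD].
  - rewrite Hp. destruct (pos_eqb_spec p p); [simpl; lia | easy].
  - specialize (IH HD). destruct (pos_eqb x p), (a x); simpl; lia.
Qed.

(** Each attachment fills a place of the finite list [D], so [missing] bounds the length of a run;
    [classic] decides whether a run can go on. *)
Lemma reached_terminal (m : Z) : 1 <= m ->
  exists al, terminal (map tile_of (labels B)) m (root B) seed_tile al.
Proof.
  intros Hm. destruct (bounded HB) as [D HD].
  assert (Hrun : forall n a, reached m a -> (missing D a < n)%nat ->
    exists al, terminal (map tile_of (labels B)) m (root B) seed_tile al).
  { induction n as [|n IH]; intros a Ha Hn; [lia|].
    destruct (classic (exists p t, attachable (map tile_of (labels B)) m a p t))
      as [(p & t & Hat)|Hstuck].
    2:{ exists a. split; [now apply reached_producible | intros p t H; apply Hstuck; eauto]. }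
    apply (IH (add_tile a p t)); [now apply reached_add|].
    destruct Hat as (Hin & Hnone & Hstr).
    apply in_map_iff in Hin. destruct Hin as (l & <- & _).
    pose proof (proj1 (faithful_producible m a Hm (reached_producible m a Ha))) as Hf.
    destruct (attachment_faithful m a p l Hm Hf Hnone Hstr) as [Hl _].
    pose proof (missing_add_lt D a p (tile_of l) (HD p l Hl) Hnone). lia. }
  apply (Hrun (S (missing D (seed_asm (root B) seed_tile))) (seed_asm (root B) seed_tile));
    [|lia].
  exists (fun _ => seed_asm (root B) seed_tile), O.
  split; [|split]; auto. intros i. now left.
Qed.

Theorem blueprint_assembles (m : Z) (X : position -> Prop) : 1 <= m ->
  (forall q, layout B q <> None <-> X q) ->
  directed (map tile_of (labels B)) m (root B) seed_tile /\
  strictly_self_assembles (map tile_of (labels B)) m (root B) seed_tile X.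
Proof.
  intros Hm HX.
  assert (Hall : forall al, terminal (map tile_of (labels B)) m (root B) seed_tile al ->
    forall q, al q = target q).
  { intros al [Hp Hst]. destruct (faithful_producible m al Hm Hp).
    now apply (stuck_complete m). }
  split; [split|].
  - now apply reached_terminal.
  - intros al be Hal Hbe q. now rewrite (Hall al), (Hall be).
  - intros al Hal q. rewrite (Hall al Hal), <- HX. unfold target.
    now destruct (layout B q).
Qed.

End Blueprint.

(** * The counter strip *)

Inductive col : Type := X0 | X1 | X2 | X3 | X4.
Inductive row : Type := Y0 | Y1 | Y2.

Definition col_Z (i : col) : Z :=
  match i with X0 => 0 | X1 => 1 | X2 => 2 | X3 => 3 | X4 => 4 end.
Definition row_Z (t : row) : Z :=
  match t with Y0 => 0 | Y1 => 1 | Y2 => 2 end.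
Definition col_of (z : Z) : col :=
  match z with 0 => X0 | 1 => X1 | 2 => X2 | 3 => X3 | _ => X4 end.
Definition row_of (z : Z) : row :=
  match z with 0 => Y0 | 1 => Y1 | _ => Y2 end.

Lemma col_Z_of (z : Z) : 0 <= z < 5 -> col_Z (col_of z) = z.
Proof.
  intros H. assert (z = 0 \/ z = 1 \/ z = 2 \/ z = 3 \/ z = 4) as E by lia.
  now repeat destruct E as [->|E]; try subst z.
Qed.

Lemma row_Z_of (z : Z) : 0 <= z < 3 -> row_Z (row_of z) = z.
Proof.
  intros H. assert (z = 0 \/ z = 1 \/ z = 2) as E by lia.
  now repeat destruct E as [->|E]; try subst z.
Qed.

(** Adding 1 flips bit [j] exactly when the carry reaches it, that is, when the [j] lower bits are
    all 1. *)
Lemma testbit_succ (V j : Z) : 0 <= j ->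
  Z.testbit (V + 1) j = xorb (Z.testbit V j) (V mod 2 ^ j =? 2 ^ j - 1).
Proof.
  intros Hj. rewrite !Z.testbit_odd, !Z.shiftr_div_pow2 by lia.
  assert (Hp : 0 < 2 ^ j) by lia.
  pose proof (Z.div_mod V (2 ^ j) ltac:(lia)) as E.
  pose proof (Z.mod_pos_bound V (2 ^ j) Hp).
  destruct (Z.eqb_spec (V mod 2 ^ j) (2 ^ j - 1)) as [Hc|Hc].
  - rewrite <- (Z.div_unique (V + 1) (2 ^ j) (V / 2 ^ j + 1) 0) by lia.
    now rewrite Z.odd_add.
  - rewrite <- (Z.div_unique (V + 1) (2 ^ j) (V / 2 ^ j) (V mod 2 ^ j + 1)) by lia.
    now rewrite xorb_false_r.
Qed.

Lemma carry_succ (V j : Z) : 0 <= j ->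
  (V mod 2 ^ (j + 1) =? 2 ^ (j + 1) - 1) =
  (V mod 2 ^ j =? 2 ^ j - 1) && Z.testbit V j.
Proof.
  intros Hj. rewrite !Z.testbit_odd, !Z.shiftr_div_pow2 by lia.
  rewrite Z.pow_add_r by lia. change (2 ^ 1) with 2.
  assert (Hp : 0 < 2 ^ j) by lia.
  set (P := 2 ^ j) in *. clearbody P.
  pose proof (Z.div_mod V P ltac:(lia)) as E.
  pose proof (Z.mod_pos_bound V P Hp).
  pose proof (Z.div2_odd (V / P)) as D.
  set (q := V / P) in *. set (a := V mod P) in *. clearbody q a.
  rewrite <- (Z.mod_unique V (P * 2) (Z.div2 q) (a + P * Z.b2z (Z.odd q))).
  - destruct (Z.odd q); simpl Z.b2z;
      destruct (Z.eqb_spec a (P - 1)); simpl; try apply Z.eqb_eq; try apply Z.eqb_neq; lia.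
  - destruct (Z.odd q); simpl Z.b2z; lia.
  - rewrite D in E. destruct (Z.odd q); simpl Z.b2z in *; lia.
Qed.

(** [Init u] is the [u]-th tile of the bottom row of a strip.  In
    [Cell rt j i t c b], [rt] tells a rightward (incrementing) pass from a
    leftward (copying) one, [j] numbers the cells of a pass, [(i, t)] is the
    place inside the cell, [c] the incoming carry and [b] the bit that was read;
    [b] is [false] at the places that growth visits before reading. *)
Inductive slabel : Type :=
| Init (u : Z)
| Cell (rt : bool) (j : Z) (i : col) (t : row) (c b : bool).

Definition fwd (rt : bool) : dir := if rt then DE else DW.
Definition bwd (rt : bool) : dir := if rt then DW else DE.
Definition next (rt : bool) (j : Z) : Z := if rt then j + 1 else j - 1.

Definition on {A : Type} (d : dir) (f : face A) (g : dir -> face A) (e : dir) : face A :=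
  if dir_eqb d e then f else g e.
Definition blank {A : Type} (_ : dir) : face A := Blank.
Definition mark {A : Type} (x : bool) : face A := if x then Repel else Blank.

Section Strip.
Context (k M : Z).

Definition first_cell (rt : bool) (j : Z) : bool := if rt then j =? 0 else j =? k.
Definition last_cell (rt : bool) (j : Z) : bool := if rt then j =? k else j =? 0.

(** The start [2 ^ k - M] makes the [M]-th increment the one that overflows [k] bits. *)
Definition value (r : Z) : Z := 2 ^ k - M + r.

(** Bits are read at [(X1, Y0)] and [(X2, Y0)]: the place that fits the bit is entered from above,
    the other one from the side. Bits are written on top of [(X3, Y2)] and [(X4, Y2)]. The first
    cell of a pass is entered from below, where the path turns. *)
Definition sarrival (l : slabel) : dir :=
  match l with
  | Init _ => DE
  | Cell rt j i t c b =>
      match i, t with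
      | X0, Y0 => if first_cell rt j then DN else fwd rt
      | X0, _ => DN
      | X1, Y0 => if b then DS else bwd rt
      | X1, Y1 => bwd rt
      | X1, Y2 => fwd rt
      | X2, Y0 => if b then fwd rt else DS
      | X2, Y1 => DS
      | X2, Y2 => fwd rt
      | X3, Y0 => fwd rt
      | X3, _ => DN
      | X4, Y2 => fwd rt
      | X4, _ => DS
      end
  end.

(** [Emit None] is the glue that leaves the strip after the overflow. *)
Definition sfaces (l : slabel) : dir -> face (option slabel) :=
  match l with
  | Init u =>
      on DN (if u mod 5 =? 3 then mark (Z.testbit (value 0) (u / 5))
             else if u mod 5 =? 4 then mark (negb (Z.testbit (value 0) (u / 5)))
             else if u =? 5 * k then Emit (Some (Cell false k X0 Y0 false false))
             else Blank)
     (on DE (if (0 <=? u) && (u <? 5 * k) then Emit (Some (Init (u + 1))) else Blank) blank)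
  | Cell rt j i t c b =>
      let go i' t' b' := Emit (Some (Cell rt j i' t' c b')) in
      match i, t with
      | X0, Y0 => on DN (go X0 Y1 false) blank
      | X0, Y1 => on DN (go X0 Y2 false) blank
      | X0, Y2 =>
          if last_cell rt j then
            on DN (if rt then
                     if c then Emit None
                     else Emit (Some (Cell false k X0 Y0 false false))
                   else Emit (Some (Cell true 0 X0 Y0 true false))) blank
          else on (fwd rt) (go X1 Y2 false) blank
      | X1, Y2 => on (fwd rt) (go X2 Y2 false) blank
      | X2, Y2 => on DS (go X2 Y1 false) blank
      | X2, Y1 => on DS (go X2 Y0 false) (on (bwd rt) (go X1 Y1 false) blank)
      | X1, Y1 => on DS (go X1 Y0 true) blank
      | X1, Y0 =>
          if b then on DS Repel (on (fwd rt) (go X2 Y0 true) blank) else blank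
      | X2, Y0 =>
          if b then on (fwd rt) (go X3 Y0 true) blank
          else on DS Repel (on (bwd rt) (go X1 Y0 false) (on (fwd rt) (go X3 Y0 false) blank))
      | X3, Y0 => on DN (go X3 Y1 b) blank
      | X3, Y1 => on DN (go X3 Y2 b) blank
      | X3, Y2 => on DN (mark (xorb b c)) (on (fwd rt) (go X4 Y2 b) blank)
      | X4, Y2 => on DN (mark (negb (xorb b c))) (on DS (go X4 Y1 b) blank)
      | X4, Y1 => on DS (go X4 Y0 b) blank
      | X4, Y0 =>
          on (fwd rt) (if first_cell rt (next rt j) then Blank
                       else Emit (Some (Cell rt (next rt j) X0 Y0 (c && b) false))) blank
      end
  end.

Lemma sface_arrival (l : slabel) (d : dir) : sfaces l d <> Blank -> sarrival l <> opp d.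
Proof.
  destruct l as [u|rt j i t c b]; simpl.
  - unfold on. now destruct d.
  - destruct i, t; unfold on, blank; simpl;
      try destruct (last_cell rt j); try destruct (first_cell rt j);
      destruct rt, b, d; simpl; congruence.
Qed.

(** Labels that never occur in the layout are included. For them [sfaces] tests [first_cell] at
    [(X4, Y0)]: a sideways emission must not name a first cell, which is entered from below. *)
Lemma semit_arrival (l : slabel) (d : dir) (l' : slabel) :
  sfaces l d = Emit (Some l') -> sarrival l' = d.
Proof.
  destruct l as [u|rt j i t c b]; simpl.
  - unfold on, mark. destruct d; simpl; try discriminate.
    + destruct (u mod 5 =? 3); [destruct (Z.testbit (value 0) (u / 5)); discriminate|].
      destruct (u mod 5 =? 4); [destruct (Z.testbit (value 0) (u / 5)); discriminate|].
      destruct (u =? 5 * k); [|discriminate].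
      intros [= <-]. simpl. now rewrite Z.eqb_refl.
    + destruct ((0 <=? u) && (u <? 5 * k)); [|discriminate]. now intros [= <-].
  - destruct i, t; unfold on, mark, blank; simpl;
      try destruct (last_cell rt j); try destruct (first_cell rt (next rt j)) eqn:Hf;
      destruct rt, b, c, d; simpl; try discriminate; intros [= <-]; simpl;
      rewrite ?Z.eqb_refl; try (simpl in Hf; rewrite Hf); reflexivity.
Qed.

(** For the contact between two strips: the top row of one, with its repelling sides, abuts left
    sides of the next. *)
Lemma sface_horizontal (l : slabel) (d : dir) : d = DE \/ d = DW -> sfaces l d <> Repel.
Proof.
  intros Hd. destruct l as [u|rt j i t c b]; simpl.
  - unfold on, blank. destruct Hd as [-> | ->]; simpl; [|easy].
    now destruct ((0 <=? u) && (u <? 5 * k)).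
  - destruct i, t; unfold on, mark, blank; simpl;
      try destruct (last_cell rt j); try destruct (first_cell rt (next rt j));
      destruct Hd as [-> | ->], rt, b; simpl; try discriminate;
      destruct c; discriminate.
Qed.

(** Columns [X1] to [X4] of the leftward cell [j] lie over columns [X4] to [X1] of the rightward
    cell [j - 1], hence the shift. *)
Definition bit (rt : bool) (r j : Z) : bool :=
  Z.testbit (value r) (if rt then j else j - 1).

Definition carry (rt : bool) (r j : Z) : bool :=
  if rt then value r mod 2 ^ j =? 2 ^ j - 1 else false.

Definition visited_after_reading (i : col) (t : row) : bool :=
  match i, t with
  | X1, Y0 | X2, Y0 | X3, _ | X4, _ => true
  | _, _ => false
  end.

Definition cell_at (rt : bool) (r j : Z) (i : col) (t : row) : slabel :=
  Cell rt j i t (carry rt r j) (visited_after_reading i t && bit rt r j).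

(** A leftward pass mirrors the cells and is shifted by one column, so that
    [j = k] starts at the right end and [j = 0] is the column in which the
    path turns back. *)
Definition cpos (rt : bool) (r j : Z) (i : col) (t : row) : position :=
  if rt then (5 * j + col_Z i, 6 * r + 4 + row_Z t)
  else (5 * j - col_Z i, 6 * r + 1 + row_Z t).

(** The label is computed by inverting [cpos]; [(u + 4) / 5] rounds up because a leftward cell
    extends to the left of column [5 * j]. *)
Definition slab (p : position) : slabel :=
  let (u, v) := p in
  if v =? 0 then Init u
  else
    let r := (v - 1) / 6 in
    let s := (v - 1) mod 6 in
    if s <? 3 then
      let j := (u + 4) / 5 in cell_at false r j (col_of (5 * j - u)) (row_of s)
    else cell_at true r (u / 5) (col_of (u mod 5)) (row_of (s - 3)).

Lemma slab_cpos (rt : bool) (r j : Z) (i : col) (t : row) : 0 <= r ->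
  slab (cpos rt r j i t) = cell_at rt r j i t.
Proof.
  intros Hr.
  assert (Hi : 0 <= col_Z i < 5) by (destruct i; simpl; lia).
  assert (Ht : 0 <= row_Z t < 3) by (destruct t; simpl; lia).
  unfold cpos, slab. destruct rt.
  - destruct (Z.eqb_spec (6 * r + 4 + row_Z t) 0); [lia|].
    rewrite <- (Z.div_unique (6 * r + 4 + row_Z t - 1) 6 r (row_Z t + 3)) by lia.
    rewrite <- (Z.mod_unique (6 * r + 4 + row_Z t - 1) 6 r (row_Z t + 3)) by lia.
    destruct (Z.ltb_spec (row_Z t + 3) 3); [lia|].
    rewrite <- (Z.div_unique (5 * j + col_Z i) 5 j (col_Z i)) by lia.
    rewrite <- (Z.mod_unique (5 * j + col_Z i) 5 j (col_Z i)) by lia.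
    now destruct i, t.
  - destruct (Z.eqb_spec (6 * r + 1 + row_Z t) 0); [lia|].
    rewrite <- (Z.div_unique (6 * r + 1 + row_Z t - 1) 6 r (row_Z t)) by lia.
    rewrite <- (Z.mod_unique (6 * r + 1 + row_Z t - 1) 6 r (row_Z t)) by lia.
    destruct (Z.ltb_spec (row_Z t) 3); [|lia].
    rewrite <- (Z.div_unique (5 * j - col_Z i + 4) 5 j (4 - col_Z i)) by lia.
    replace (5 * j - (5 * j - col_Z i)) with (col_Z i) by lia.
    now destruct i, t.
Qed.

Lemma slab_init (u : Z) : slab (u, 0) = Init u.
Proof. reflexivity. Qed.

Definition in_strip (p : position) : Prop := 0 <= fst p <= 5 * k /\ 0 <= snd p <= 6 * M.

(** The last cell of a pass consists only of the column in which the path climbs to turn back or to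
    leave. *)
Definition valid (rt : bool) (r j : Z) (i : col) : Prop :=
  0 <= r < M /\ 0 <= j <= k /\ (last_cell rt j = true -> i = X0).

Lemma in_strip_cpos (rt : bool) (r j : Z) (i : col) (t : row) :
  valid rt r j i -> in_strip (cpos rt r j i t).
Proof.
  intros (Hr & Hj & Hl).
  assert (Ht : 0 <= row_Z t < 3) by (destruct t; simpl; lia).
  unfold cpos, in_strip, last_cell in *.
  destruct rt; simpl.
  - destruct (Z.eqb_spec j k) as [->|]; [rewrite Hl by auto; simpl; lia|].
    destruct i; simpl; lia.
  - destruct (Z.eqb_spec j 0) as [->|]; [rewrite Hl by auto; simpl; lia|].
    destruct i; simpl; lia.
Qed.

Lemma in_strip_cases (p : position) : in_strip p ->
  (exists u, p = (u, 0) /\ 0 <= u <= 5 * k) \/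
  (exists rt r j i t, p = cpos rt r j i t /\ valid rt r j i).
Proof.
  destruct p as [u v]. unfold in_strip; simpl. intros [Hu Hv].
  destruct (Z.eq_dec v 0) as [->|Hv0]; [left; eauto|right].
  pose proof (Z.div_mod (v - 1) 6 ltac:(lia)) as E.
  pose proof (Z.mod_pos_bound (v - 1) 6 ltac:(lia)) as Hs.
  set (r := (v - 1) / 6) in *. set (s := (v - 1) mod 6) in *.
  destruct (Z_lt_ge_dec s 3).
  - exists false, r, ((u + 4) / 5), (col_of (5 * ((u + 4) / 5) - u)), (row_of s).
    pose proof (Z.div_mod (u + 4) 5 ltac:(lia)) as F.
    pose proof (Z.mod_pos_bound (u + 4) 5 ltac:(lia)) as G.
    unfold cpos, valid, last_cell. rewrite col_Z_of, row_Z_of by lia.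
    split; [f_equal; lia|]. split; [lia|]. split; [lia|].
    intros H. apply Z.eqb_eq in H.
    replace (5 * ((u + 4) / 5) - u) with 0 by lia. reflexivity.
  - exists true, r, (u / 5), (col_of (u mod 5)), (row_of (s - 3)).
    pose proof (Z.div_mod u 5 ltac:(lia)) as F.
    pose proof (Z.mod_pos_bound u 5 ltac:(lia)) as G.
    unfold cpos, valid, last_cell. rewrite col_Z_of, row_Z_of by lia.
    split; [f_equal; lia|]. split; [lia|]. split; [lia|].
    intros H. apply Z.eqb_eq in H.
    replace (u mod 5) with 0 by lia. reflexivity.
Qed.

Context (Hk : 1 <= k) (HM : 1 <= M <= 2 ^ k).

(** The carry into bit 0 is the 1 that the pass adds. *)
Lemma carry_first (r : Z) : carry true r 0 = true.
Proof. unfold carry. simpl. now rewrite Z.mod_1_r. Qed.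

Lemma carry_next (rt : bool) (r j : Z) : 0 <= j ->
  carry rt r (next rt j) = carry rt r j && bit rt r j.
Proof. intros Hj. destruct rt; [now apply carry_succ | reflexivity]. Qed.

Lemma carry_last (r : Z) : 0 <= r < M -> carry true r k = (r =? M - 1).
Proof.
  intros Hr. unfold carry, value. rewrite Z.mod_small by lia.
  destruct (Z.eqb_spec r (M - 1)); [apply Z.eqb_eq | apply Z.eqb_neq]; lia.
Qed.

(** The tile under [X1] repels on a 0, the one under [X2] on a 1. A rightward pass reads the copy
    left by the leftward pass below it; a leftward pass reads the row incremented in the previous
    cycle or, in cycle 0, the initial row. *)
Lemma below_reader (rt : bool) (r j : Z) : valid rt r j X1 ->
  in_strip (move (cpos rt r j X1 Y0) DS) /\ in_strip (move (cpos rt r j X2 Y0) DS) /\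
  sfaces (slab (move (cpos rt r j X1 Y0) DS)) DN = mark (negb (bit rt r j)) /\
  sfaces (slab (move (cpos rt r j X2 Y0) DS)) DN = mark (bit rt r j).
Proof.
  intros (Hr & Hj & Hl). destruct rt; simpl in Hl.
  - destruct (Z.eqb_spec j k) as [E|E]; [now discriminate Hl|].
    assert (Hv : forall i, valid false r (j + 1) i).
    { intros i. repeat split; try lia. simpl. intros H. apply Z.eqb_eq in H. lia. }
    replace (move (cpos true r j X1 Y0) DS) with (cpos false r (j + 1) X4 Y2)
      by (simpl; f_equal; lia).
    replace (move (cpos true r j X2 Y0) DS) with (cpos false r (j + 1) X3 Y2)
      by (simpl; f_equal; lia).
    rewrite !slab_cpos by lia. repeat split; try (now apply in_strip_cpos).
    all: unfold cell_at, bit; simpl; replace (j + 1 - 1) with j by lia;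
      now rewrite xorb_false_r.
  - destruct (Z.eqb_spec j 0) as [E|E]; [now discriminate Hl|].
    destruct (Z.eq_dec r 0) as [->|Hr0].
    + replace (move (cpos false 0 j X1 Y0) DS) with (5 * j - 1, 0) by reflexivity.
      replace (move (cpos false 0 j X2 Y0) DS) with (5 * j - 2, 0) by reflexivity.
      rewrite !slab_init. unfold in_strip; simpl.
      rewrite <- (Z.div_unique (5 * j - 1) 5 (j - 1) 4), <- (Z.mod_unique (5 * j - 1) 5 (j - 1) 4),
        <- (Z.div_unique (5 * j - 2) 5 (j - 1) 3), <- (Z.mod_unique (5 * j - 2) 5 (j - 1) 3)
        by lia.
      repeat split; lia.
    + assert (Hv : forall i, valid true (r - 1) (j - 1) i).
      { intros i. repeat split; try lia. simpl. intros H. apply Z.eqb_eq in H. lia. }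
      replace (move (cpos false r j X1 Y0) DS) with (cpos true (r - 1) (j - 1) X4 Y2)
        by (simpl; f_equal; lia).
      replace (move (cpos false r j X2 Y0) DS) with (cpos true (r - 1) (j - 1) X3 Y2)
        by (simpl; f_equal; lia).
      rewrite !slab_cpos by lia. repeat split; try (now apply in_strip_cpos).
      all: unfold cell_at, bit, carry; simpl; rewrite <- testbit_succ by lia;
        replace (value (r - 1) + 1) with (value r) by (unfold value; lia); reflexivity.
Qed.

Lemma cpos_nonzero (rt : bool) (r j : Z) (i : col) (t : row) : 0 <= r ->
  cpos rt r j i t <> (0, 0).
Proof.
  intros Hr E. apply (f_equal snd) in E. destruct rt, t; simpl in E; lia.
Qed.

Lemma valid_inner (rt : bool) (r j : Z) (i i' : col) :
  valid rt r j i -> i <> X0 -> valid rt r j i'.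
Proof. intros (Hr & Hj & Hl) Hi. repeat split; try lia. intros H. now apply Hl in H. Qed.

Lemma valid_inner_last (rt : bool) (r j : Z) (i : col) :
  valid rt r j i -> i <> X0 -> last_cell rt j = false.
Proof.
  intros (Hr & Hj & Hl) Hi. destruct (last_cell rt j); auto. exfalso. auto.
Qed.

Lemma valid_next (rt : bool) (r j : Z) (i : col) :
  valid rt r j i -> last_cell rt j = false -> valid rt r (next rt j) X0.
Proof.
  intros (Hr & Hj & Hl) H. repeat split; try lia; auto;
    destruct rt; simpl in *; apply Z.eqb_neq in H; lia.
Qed.

Ltac same_place :=
  match goal with |- ?p = cpos ?rt _ _ _ _ =>
    try (is_var rt; destruct rt); simpl; f_equal; lia end.

Ltac step_to rt r j i t :=
  match goal with |- context [move (cpos ?a ?b ?c ?e ?f) ?d] =>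
    replace (move (cpos a b c e f) d) with (cpos rt r j i t) by (symmetry; same_place)
  end.

(** The two reading places are the only ones whose parent depends on the bit. *)
Lemma sparent (p : position) : in_strip p -> p <> (0, 0) ->
  in_strip (move p (opp (sarrival (slab p)))) /\
  sfaces (slab (move p (opp (sarrival (slab p))))) (sarrival (slab p)) = Emit (Some (slab p)).
Proof.
  intros Hp H0. apply in_strip_cases in Hp.
  destruct Hp as [(u & -> & Hu)|(rt & r & j & i & t & -> & Hv)].
  - rewrite slab_init. simpl.
    assert (u <> 0) by congruence.
    split; [unfold in_strip; simpl; lia|]. simpl.
    destruct (Z.leb_spec 0 (u - 1)), (Z.ltb_spec (u - 1) (5 * k)); try lia.
    now replace (u - 1 + 1) with u by lia.
  - destruct Hv as (Hr & Hj & Hl). assert (Hv : valid rt r j i) by (split; auto).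
    rewrite !slab_cpos by lia.
    assert (Hsame : forall i' t', valid rt r j i' ->
      move (cpos rt r j i t) (opp (sarrival (cell_at rt r j i t))) = cpos rt r j i' t' ->
      sfaces (cell_at rt r j i' t') (sarrival (cell_at rt r j i t))
        = Emit (Some (cell_at rt r j i t)) ->
      in_strip (move (cpos rt r j i t) (opp (sarrival (cell_at rt r j i t)))) /\
      sfaces (slab (move (cpos rt r j i t) (opp (sarrival (cell_at rt r j i t)))))
        (sarrival (cell_at rt r j i t)) = Emit (Some (cell_at rt r j i t))).
    { intros i' t' Hv' -> E. rewrite slab_cpos by lia. split; auto.
      now apply in_strip_cpos. }
    assert (Hin : i <> X0 -> forall i', valid rt r j i')
      by (intros; eapply valid_inner; eauto).
    assert (Hlast : i <> X0 -> last_cell rt j = false)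
      by (intros; eapply valid_inner_last; eauto).
    destruct i; [|specialize (Hin ltac:(discriminate)); specialize (Hlast ltac:(discriminate))..];
      destruct t.
    + destruct (first_cell rt j) eqn:Hf.
      * assert (Ha : sarrival (cell_at rt r j X0 Y0) = DN)
          by (unfold cell_at; simpl; now rewrite Hf).
        rewrite Ha. destruct rt; simpl in Hf; apply Z.eqb_eq in Hf; subst j.
        -- step_to false r 0 X0 Y2. rewrite slab_cpos by lia.
           split; [apply in_strip_cpos; repeat split; auto; lia|].
           unfold cell_at. now rewrite carry_first.
        -- destruct (Z.eq_dec r 0) as [->|Hr0].
           ++ replace (move (cpos false 0 k X0 Y0) (opp DN)) with (5 * k, 0)
                by (simpl; f_equal; lia).
              rewrite slab_init. split; [unfold in_strip; simpl; lia|]. simpl.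
              replace (5 * k mod 5) with 0
                by (rewrite Z.mul_comm, Z.mod_mul; lia).
              now rewrite Z.eqb_refl.
           ++ step_to true (r - 1) k X0 Y2. rewrite slab_cpos by lia.
              split; [apply in_strip_cpos; repeat split; auto; lia|].
              unfold cell_at. rewrite carry_last by lia. simpl. rewrite Z.eqb_refl.
              destruct (Z.eqb_spec (r - 1) (M - 1)); [lia | reflexivity].
      * assert (Ha : sarrival (cell_at rt r j X0 Y0) = fwd rt)
          by (unfold cell_at; simpl; now rewrite Hf).
        rewrite Ha. pose (j' := if rt then j - 1 else j + 1).
        assert (Hn : next rt j' = j) by (unfold j'; destruct rt; simpl; lia).
        assert (Hv' : valid rt r j' X4).
        { unfold j'. destruct rt; simpl in *; apply Z.eqb_neq in Hf; repeat split; try lia;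
            intros H; apply Z.eqb_eq in H; lia. }
        replace (move (cpos rt r j X0 Y0) (opp (fwd rt))) with (cpos rt r j' X4 Y0)
          by (unfold j'; destruct rt; simpl; f_equal; lia).
        rewrite slab_cpos by lia. split; [now apply in_strip_cpos|].
        unfold cell_at; simpl. rewrite <- carry_next, Hn, Hf by (destruct Hv'; lia).
        now destruct rt.
    + apply (Hsame X0 Y0); [auto | same_place | reflexivity].
    + apply (Hsame X0 Y1); [auto | same_place | reflexivity].
    + unfold cell_at in *; simpl in *. destruct (bit rt r j) eqn:Hb.
      * apply (Hsame X1 Y1); [auto | same_place |]. now rewrite ?Hb.
      * apply (Hsame X2 Y0); [auto | same_place |]. simpl. rewrite ?Hb. now destruct rt.
    + apply (Hsame X2 Y1); [auto | same_place |]. now destruct rt.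
    + apply (Hsame X0 Y2); [auto | same_place |]. unfold cell_at; simpl. rewrite Hlast.
      now destruct rt.
    + unfold cell_at in *; simpl in *. destruct (bit rt r j) eqn:Hb.
      * apply (Hsame X1 Y0); [auto | same_place |]. simpl. rewrite ?Hb. now destruct rt.
      * apply (Hsame X2 Y1); [auto | same_place |]. now rewrite ?Hb.
    + apply (Hsame X2 Y2); [auto | same_place | reflexivity].
    + apply (Hsame X1 Y2); [auto | same_place |]. now destruct rt.
    + apply (Hsame X2 Y0); [auto | same_place |]. unfold cell_at; simpl.
      destruct (bit rt r j); now destruct rt.
    + apply (Hsame X3 Y0); [auto | same_place | reflexivity].
    + apply (Hsame X3 Y1); [auto | same_place | reflexivity].
    + apply (Hsame X4 Y1); [auto | same_place | reflexivity].
    + apply (Hsame X4 Y2); [auto | same_place | reflexivity].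
    + apply (Hsame X3 Y2); [auto | same_place |]. now destruct rt.
Qed.

(** * The order of growth within one strip *)

Inductive sbefore (q : position) : position -> Prop :=
| sbefore_refl : sbefore q q
| sbefore_step p : in_strip p -> p <> (0, 0) ->
    sbefore q (move p (opp (sarrival (slab p)))) -> sbefore q p.

Lemma sbefore_trans (p q s : position) : sbefore p q -> sbefore q s -> sbefore p s.
Proof.
  intros H1 H2. induction H2; auto. apply sbefore_step; auto.
Qed.

Lemma sbefore_hop (rt : bool) (r j : Z) (i : col) (t : row) (q : position) :
  valid rt r j i ->
  q = move (cpos rt r j i t) (opp (sarrival (cell_at rt r j i t))) ->
  sbefore q (cpos rt r j i t).
Proof.
  intros Hv ->. assert (0 <= r) by (destruct Hv; lia).
  apply sbefore_step.
  - now apply in_strip_cpos.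
  - now apply cpos_nonzero.
  - rewrite slab_cpos by lia. apply sbefore_refl.
Qed.

Lemma cell_column (rt : bool) (r j : Z) : valid rt r j X0 ->
  sbefore (cpos rt r j X0 Y0) (cpos rt r j X0 Y1) /\
  sbefore (cpos rt r j X0 Y1) (cpos rt r j X0 Y2).
Proof.
  intros Hv. split; (apply sbefore_hop; [auto | symmetry; same_place]).
Qed.

(** The second half is restricted because [(X1, Y1)] is a dead end when the bit is 0. It covers the
    top row, which bears the written bits, and the column [X0], which contains the left border of
    the strip. *)
Lemma cell_path (rt : bool) (r j : Z) (i : col) (t : row) : valid rt r j X1 ->
  sbefore (cpos rt r j X0 Y0) (cpos rt r j i t) /\
  (i = X0 \/ t = Y2 -> sbefore (cpos rt r j i t) (cpos rt r j X4 Y0)).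
Proof.
  intros Hv.
  assert (Hin : forall i', valid rt r j i')
    by (intros i'; apply (valid_inner rt r j X1); easy).
  destruct (cell_column rt r j (Hin X0)) as [h1 h2].
  assert (h3 : sbefore (cpos rt r j X0 Y2) (cpos rt r j X1 Y2))
    by (apply sbefore_hop; [auto | symmetry; same_place]).
  assert (h4 : sbefore (cpos rt r j X1 Y2) (cpos rt r j X2 Y2))
    by (apply sbefore_hop; [auto | symmetry; same_place]).
  assert (h5 : sbefore (cpos rt r j X2 Y2) (cpos rt r j X2 Y1))
    by (apply sbefore_hop; [auto | symmetry; same_place]).
  assert (h6 : sbefore (cpos rt r j X2 Y1) (cpos rt r j X1 Y1))
    by (apply sbefore_hop; [auto | symmetry; same_place]).
  assert (h7 : sbefore (cpos rt r j X2 Y1) (cpos rt r j X1 Y0) /\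
               sbefore (cpos rt r j X2 Y1) (cpos rt r j X2 Y0)).
  (* The bit decides which reading place comes first: a 1 is read at [X1], from which [X2] is
     filled; a 0 is read at [X2], from which [X1] is filled. *)
  { destruct (bit rt r j) eqn:Hb.
    - assert (sbefore (cpos rt r j X1 Y1) (cpos rt r j X1 Y0))
        by (apply sbefore_hop; [auto | unfold cell_at; rewrite Hb; symmetry; same_place]).
      assert (sbefore (cpos rt r j X1 Y0) (cpos rt r j X2 Y0))
        by (apply sbefore_hop; [auto | unfold cell_at; rewrite Hb; symmetry; same_place]).
      eauto using sbefore_trans.
    - assert (sbefore (cpos rt r j X2 Y1) (cpos rt r j X2 Y0))
        by (apply sbefore_hop; [auto | unfold cell_at; rewrite Hb; symmetry; same_place]).
      assert (sbefore (cpos rt r j X2 Y0) (cpos rt r j X1 Y0))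
        by (apply sbefore_hop; [auto | unfold cell_at; rewrite Hb; symmetry; same_place]).
      eauto using sbefore_trans. }
  destruct h7 as [h7 h8].
  assert (h9 : sbefore (cpos rt r j X2 Y0) (cpos rt r j X3 Y0))
    by (apply sbefore_hop; [auto | symmetry; same_place]).
  assert (h10 : sbefore (cpos rt r j X3 Y0) (cpos rt r j X3 Y1))
    by (apply sbefore_hop; [auto | symmetry; same_place]).
  assert (h11 : sbefore (cpos rt r j X3 Y1) (cpos rt r j X3 Y2))
    by (apply sbefore_hop; [auto | symmetry; same_place]).
  assert (h12 : sbefore (cpos rt r j X3 Y2) (cpos rt r j X4 Y2))
    by (apply sbefore_hop; [auto | symmetry; same_place]).
  assert (h13 : sbefore (cpos rt r j X4 Y2) (cpos rt r j X4 Y1))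
    by (apply sbefore_hop; [auto | symmetry; same_place]).
  assert (h14 : sbefore (cpos rt r j X4 Y1) (cpos rt r j X4 Y0))
    by (apply sbefore_hop; [auto | symmetry; same_place]).
  pose proof (sbefore_trans _ _ _ h1 h2) as a2.
  pose proof (sbefore_trans _ _ _ a2 h3) as a3.
  pose proof (sbefore_trans _ _ _ a3 h4) as a4.
  pose proof (sbefore_trans _ _ _ a4 h5) as a5.
  pose proof (sbefore_trans _ _ _ a5 h6) as a6.
  pose proof (sbefore_trans _ _ _ a5 h7) as a7.
  pose proof (sbefore_trans _ _ _ a5 h8) as a8.
  pose proof (sbefore_trans _ _ _ a8 h9) as a9.
  pose proof (sbefore_trans _ _ _ a9 h10) as a10.
  pose proof (sbefore_trans _ _ _ a10 h11) as a11.
  pose proof (sbefore_trans _ _ _ a11 h12) as a12.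
  pose proof (sbefore_trans _ _ _ a12 h13) as a13.
  pose proof (sbefore_trans _ _ _ a13 h14) as a14.
  pose proof (sbefore_trans _ _ _ h13 h14) as b12.
  pose proof (sbefore_trans _ _ _ h12 b12) as b11.
  pose proof (sbefore_trans _ _ _ h8 (sbefore_trans _ _ _ h9
    (sbefore_trans _ _ _ h10 (sbefore_trans _ _ _ h11 b11)))) as b6.
  pose proof (sbefore_trans _ _ _ h5 b6) as b5.
  pose proof (sbefore_trans _ _ _ h4 b5) as b4.
  pose proof (sbefore_trans _ _ _ h3 b4) as b3.
  pose proof (sbefore_trans _ _ _ h2 b3) as b2.
  split.
  - destruct i, t; auto using sbefore_refl.
  - intros Hit. destruct i, t; auto; destruct Hit; discriminate.
Qed.

Lemma cell_to_next (rt : bool) (r j : Z) : valid rt r j X1 ->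
  sbefore (cpos rt r j X4 Y0) (cpos rt r (next rt j) X0 Y0).
Proof.
  intros Hv. pose proof (valid_inner_last _ _ _ _ Hv ltac:(discriminate)) as Hl.
  apply sbefore_hop; [now apply (valid_next rt r j X1)|].
  unfold cell_at; simpl.
  assert (Hf : first_cell rt (next rt j) = false).
  { destruct Hv as (Hr & Hj & _). destruct rt; simpl; apply Z.eqb_neq; lia. }
  rewrite Hf. destruct rt; simpl; f_equal; lia.
Qed.

(** Cells numbered in the order of travel, so that both kinds of passes share one induction. *)
Definition nth_cell (rt : bool) (n : Z) : Z := if rt then n else k - n.
Definition row_start (rt : bool) (r : Z) : position := cpos rt r (nth_cell rt 0) X0 Y0.
Definition row_end (rt : bool) (r : Z) : position := cpos rt r (nth_cell rt k) X0 Y2.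

Lemma valid_nth_cell (rt : bool) (r n : Z) (i : col) :
  0 <= r < M -> 0 <= n <= k -> (n = k -> i = X0) -> valid rt r (nth_cell rt n) i.
Proof.
  intros Hr Hn Hi. repeat split; try lia; try (destruct rt; simpl; lia).
  destruct rt; simpl; intros H; apply Z.eqb_eq in H; apply Hi; lia.
Qed.

Lemma row_path (rt : bool) (r a n : Z) : 0 <= r < M -> 0 <= a -> 0 <= n -> a + n <= k ->
  sbefore (cpos rt r (nth_cell rt a) X0 Y0) (cpos rt r (nth_cell rt (a + n)) X0 Y0).
Proof.
  intros Hr Ha Hn. revert n Hn.
  apply (natlike_ind (fun n => a + n <= k ->
    sbefore (cpos rt r (nth_cell rt a) X0 Y0) (cpos rt r (nth_cell rt (a + n)) X0 Y0))).
  - intros _. rewrite Z.add_0_r. apply sbefore_refl.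
  - intros n Hn IH Hle.
    apply (sbefore_trans _ (cpos rt r (nth_cell rt (a + n)) X0 Y0)); [apply IH; lia|].
    assert (Hv : valid rt r (nth_cell rt (a + n)) X1)
      by (apply valid_nth_cell; lia).
    replace (nth_cell rt (a + Z.succ n)) with (next rt (nth_cell rt (a + n)))
      by (destruct rt; simpl; lia).
    eapply sbefore_trans; [|now apply cell_to_next].
    apply (cell_path rt r _ X4 Y0 Hv).
Qed.

Lemma nth_cell_of (rt : bool) (j : Z) : 0 <= j <= k ->
  exists n, 0 <= n <= k /\ j = nth_cell rt n.
Proof. intros Hj. exists (nth_cell rt j). destruct rt; simpl; lia. Qed.

Lemma last_nth_cell (rt : bool) (n : Z) : last_cell rt (nth_cell rt n) = (n =? k).
Proof.
  destruct rt; simpl; auto. destruct (Z.eqb_spec n k); [apply Z.eqb_eq | apply Z.eqb_neq]; lia.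
Qed.

Lemma row_start_before (rt : bool) (r j : Z) (i : col) (t : row) :
  valid rt r j i -> sbefore (row_start rt r) (cpos rt r j i t).
Proof.
  intros (Hr & Hj & Hl). destruct (nth_cell_of rt j Hj) as (n & Hn & ->).
  rewrite last_nth_cell in Hl.
  eapply sbefore_trans; [apply (row_path rt r 0 n); lia|]. rewrite Z.add_0_l.
  destruct (Z.eqb_spec n k) as [E|Hnk].
  - subst n. rewrite Hl by auto.
    destruct (cell_column rt r (nth_cell rt k)) as [h1 h2];
      [now apply valid_nth_cell; try lia|].
    destruct t; [apply sbefore_refl | exact h1 | exact (sbefore_trans _ _ _ h1 h2)].
  - apply cell_path. apply valid_nth_cell; lia.
Qed.

Lemma before_row_end (rt : bool) (r j : Z) (i : col) (t : row) :
  valid rt r j i -> i = X0 \/ t = Y2 -> sbefore (cpos rt r j i t) (row_end rt r).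
Proof.
  intros (Hr & Hj & Hl) Hit. destruct (nth_cell_of rt j Hj) as (n & Hn & ->).
  rewrite last_nth_cell in Hl.
  destruct (cell_column rt r (nth_cell rt k)) as [h1 h2];
    [now apply valid_nth_cell; try lia|].
  pose proof (sbefore_trans _ _ _ h1 h2) as h12.
  destruct (Z.eqb_spec n k) as [E|Hnk].
  - subst n. rewrite Hl by auto. destruct t; auto. apply sbefore_refl.
  - assert (Hv : valid rt r (nth_cell rt n) X1) by (apply valid_nth_cell; lia).
    eapply sbefore_trans; [now apply (cell_path rt r _ i t Hv)|].
    eapply sbefore_trans; [now apply cell_to_next|].
    replace (next rt (nth_cell rt n)) with (nth_cell rt (n + 1))
      by (destruct rt; simpl; lia).
    eapply sbefore_trans; [apply (row_path rt r (n + 1) (k - (n + 1))); lia|].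
    replace (n + 1 + (k - (n + 1))) with k by lia. exact h12.
Qed.

Lemma turn_left_right (r : Z) : 0 <= r < M -> sbefore (row_end false r) (row_start true r).
Proof.
  intros Hr. apply sbefore_hop; [apply valid_nth_cell; lia|].
  simpl. f_equal; lia.
Qed.

Lemma turn_right_left (r : Z) : 0 <= r -> r + 1 < M ->
  sbefore (row_end true r) (row_start false (r + 1)).
Proof.
  intros Hr Hr'. apply sbefore_hop; [apply valid_nth_cell; lia|].
  unfold cell_at, nth_cell. rewrite Z.sub_0_r. simpl. rewrite Z.eqb_refl.
  unfold row_end, nth_cell. simpl. f_equal; lia.
Qed.

Lemma turn_init : sbefore (5 * k, 0) (row_start false 0).
Proof.
  apply sbefore_hop; [apply valid_nth_cell; lia|].
  unfold cell_at, nth_cell. rewrite Z.sub_0_r. simpl. rewrite Z.eqb_refl.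
  unfold row_end, nth_cell. simpl. f_equal; lia.
Qed.

Lemma init_path (u n : Z) : 0 <= u -> 0 <= n -> u + n <= 5 * k ->
  sbefore (u, 0) (u + n, 0).
Proof.
  intros Hu Hn. revert n Hn. apply (natlike_ind (fun n => u + n <= 5 * k ->
    sbefore (u, 0) (u + n, 0))).
  - intros _. rewrite Z.add_0_r. apply sbefore_refl.
  - intros n Hn IH Hle. apply sbefore_step.
    + unfold in_strip; simpl; lia.
    + intros E. injection E. lia.
    + simpl. replace (u + Z.succ n - 1) with (u + n) by lia. apply IH. lia.
Qed.

Lemma row_end_start_row (rt : bool) (r : Z) : 0 <= r < M ->
  sbefore (row_start rt r) (row_end rt r).
Proof.
  intros Hr. apply row_start_before. apply valid_nth_cell; try lia; auto.
Qed.

Lemma origin_before_row (rt : bool) (r : Z) : 0 <= r < M -> sbefore (0, 0) (row_start rt r).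
Proof.
  intros [Hr HrM].
  assert (H : sbefore (0, 0) (row_start false r)).
  { revert r Hr HrM. apply (natlike_ind (fun r => r < M -> sbefore (0, 0) (row_start false r))).
    - intros _. eapply sbefore_trans; [|apply turn_init].
      apply (init_path 0 (5 * k)); lia.
    - intros r Hr IH HrM. eapply sbefore_trans; [apply IH; lia|].
      eapply sbefore_trans; [apply row_end_start_row; lia|].
      eapply sbefore_trans; [apply turn_left_right; lia|].
      eapply sbefore_trans; [apply row_end_start_row; lia|].
      apply turn_right_left; lia. }
  destruct rt; auto.
  eapply sbefore_trans; [exact H|].
  eapply sbefore_trans; [apply row_end_start_row; lia|].
  apply turn_left_right; lia.
Qed.

Definition exit : position := (5 * k, 6 * M).

Lemma row_end_exit : row_end true (M - 1) = exit.
Proof. unfold row_end, exit, cpos, nth_cell. simpl. f_equal; lia. Qed.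

Lemma row_before_exit (rt : bool) (r : Z) : 0 <= r < M -> sbefore (row_start rt r) exit.
Proof.
  intros Hr.
  assert (H : sbefore (row_start true r) exit).
  { rewrite <- row_end_exit.
    (* Downward induction: [M - 1 - r] counts the cycles that remain. *)
    replace r with (M - 1 - (M - 1 - r)) in Hr |- * by lia.
    assert (Hn : 0 <= M - 1 - r) by lia. revert Hn Hr. generalize (M - 1 - r). clear r.
    intros n Hn. revert n Hn. apply (natlike_ind (fun n => 0 <= M - 1 - n < M ->
      sbefore (row_start true (M - 1 - n)) (row_end true (M - 1)))).
    - intros _. rewrite Z.sub_0_r. apply row_end_start_row. lia.
    - intros n Hn IH Hr. eapply sbefore_trans; [|apply IH; lia].
      eapply sbefore_trans; [apply row_end_start_row; lia|].
      eapply sbefore_trans; [apply turn_right_left; lia|].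
      replace (M - 1 - Z.succ n + 1) with (M - 1 - n) by lia.
      eapply sbefore_trans; [apply row_end_start_row; lia|].
      apply turn_left_right; lia. }
  destruct rt; auto.
  eapply sbefore_trans; [|exact H].
  eapply sbefore_trans; [apply row_end_start_row; lia|].
  apply turn_left_right; lia.
Qed.

Lemma origin_before (p : position) : in_strip p -> sbefore (0, 0) p.
Proof.
  intros Hp. apply in_strip_cases in Hp.
  destruct Hp as [(u & -> & Hu)|(rt & r & j & i & t & -> & Hv)].
  - apply (init_path 0 u); lia.
  - eapply sbefore_trans; [apply (origin_before_row rt r); destruct Hv; lia|].
    now apply row_start_before.
Qed.

Lemma cell_before_exit (rt : bool) (r j : Z) (i : col) (t : row) :
  valid rt r j i -> i = X0 \/ t = Y2 -> sbefore (cpos rt r j i t) exit.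
Proof.
  intros Hv Hit. assert (Hr : 0 <= r < M) by (destruct Hv; lia).
  eapply sbefore_trans; [now apply before_row_end|].
  destruct rt.
  - destruct (Z.eq_dec r (M - 1)) as [->|].
    + rewrite row_end_exit. apply sbefore_refl.
    + eapply sbefore_trans; [apply turn_right_left; lia|].
      apply row_before_exit; lia.
  - eapply sbefore_trans; [apply turn_left_right; lia|].
    apply row_before_exit; lia.
Qed.

(* The places that are visited only by side branches, [(X1, Y0)] and [(X1, Y1)],
   are neither in the left column nor in the top row. *)
Lemma boundary_before_exit (p : position) : in_strip p -> fst p = 0 \/ snd p = 6 * M ->
  sbefore p exit.
Proof.
  intros Hp Hb. apply in_strip_cases in Hp.
  destruct Hp as [(u & -> & Hu)|(rt & r & j & i & t & -> & Hv)].
  - eapply sbefore_trans; [apply (init_path u (5 * k - u)); lia|].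
    replace (u + (5 * k - u)) with (5 * k) by lia.
    eapply sbefore_trans; [apply turn_init|]. apply row_before_exit; lia.
  - apply cell_before_exit; auto.
    destruct Hv as (Hr & Hj & Hl).
    destruct Hb as [Hb|Hb].
    + left. destruct rt; simpl in *.
      * destruct i; simpl in Hb; lia || auto.
      * destruct (Z.eqb_spec j 0); auto. destruct i; simpl in Hb; lia || auto.
    + right. destruct rt, t; simpl in Hb; lia || auto.
Qed.

(** What is read stands in the initial row or in the top row of the previous pass, both of which lie
    on the path itself and not on a side branch. So a repelling side is there before the tile that
    it has to forbid is offered. *)
Lemma below_reader_before (rt : bool) (r j : Z) (i : col) (j' : Z) (i' : col) (t' : row) :
  valid rt r j X1 -> i = X1 \/ i = X2 -> valid rt r j' i' ->
  sbefore (move (cpos rt r j i Y0) DS) (cpos rt r j' i' t').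
Proof.
  intros (Hr & Hj & Hl) Hi Hv'.
  eapply sbefore_trans; [|now apply row_start_before].
  destruct rt; simpl in Hl.
  - destruct (Z.eqb_spec j k) as [E|E]; [now discriminate Hl|].
    eapply sbefore_trans; [|now apply turn_left_right].
    pose (i'' := match i with X1 => X4 | _ => X3 end).
    replace (move (cpos true r j i Y0) DS) with (cpos false r (j + 1) i'' Y2)
      by (unfold i''; destruct Hi as [-> | ->]; simpl; f_equal; lia).
    apply before_row_end; auto. repeat split; try lia.
    simpl. intros H. apply Z.eqb_eq in H. lia.
  - destruct (Z.eqb_spec j 0) as [E|E]; [now discriminate Hl|].
    destruct (Z.eq_dec r 0) as [->|Hr0].
    + eapply sbefore_trans; [|apply turn_init].
      replace (move (cpos false 0 j i Y0) DS) with (5 * j - col_Z i, 0) by reflexivity.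
      replace (5 * k) with (5 * j - col_Z i + (5 * k - (5 * j - col_Z i))) by lia.
      apply init_path; destruct Hi as [-> | ->]; simpl; lia.
    + pose (i'' := match i with X1 => X4 | _ => X3 end).
      replace (move (cpos false r j i Y0) DS) with (cpos true (r - 1) (j - 1) i'' Y2)
        by (unfold i''; destruct Hi as [-> | ->]; simpl; f_equal; lia).
      eapply sbefore_trans; [apply before_row_end; auto; repeat split; try lia|].
      { simpl. intros H. apply Z.eqb_eq in H. lia. }
      replace r with (r - 1 + 1) at 2 by lia. apply turn_right_left; lia.
Qed.

(** Only the fork offers wrong tiles: [(X1, Y1)] offers the reading of a 1 and [(X2, Y1)] that of a
    0, and the tile below stops the one that contradicts the bit. *)
Lemma semit (q : position) (d : dir) (l : slabel) : in_strip q ->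
  sfaces (slab q) d = Emit (Some l) ->
  (in_strip (move q d) /\ slab (move q d) = l) \/
  (in_strip (move (move q d) DS) /\ sbefore (move (move q d) DS) q /\
   sfaces (slab (move (move q d) DS)) DN = Repel /\ sfaces l DS = Repel).
Proof.
  intros Hq H. apply in_strip_cases in Hq.
  destruct Hq as [(u & -> & Hu)|(rt & r & j & i & t & -> & Hv)].
  - left. rewrite slab_init in H. simpl in H. unfold on, mark, blank in H.
    destruct d; simpl in H; try discriminate.
    + destruct (u mod 5 =? 3); [destruct (Z.testbit (value 0) (u / 5)); discriminate|].
      destruct (u mod 5 =? 4); [destruct (Z.testbit (value 0) (u / 5)); discriminate|].
      destruct (Z.eqb_spec u (5 * k)) as [->|]; [|discriminate]. injection H as <-.
      replace (move (5 * k, 0) DN) with (cpos false 0 k X0 Y0) by (simpl; f_equal; lia).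
      rewrite slab_cpos by lia. split; [|reflexivity].
      apply in_strip_cpos. repeat split; auto; lia.
    + destruct (Z.leb_spec 0 u), (Z.ltb_spec u (5 * k)); try discriminate.
      injection H as <-. split; [unfold in_strip; simpl; lia | reflexivity].
  - assert (Hr : 0 <= r < M) by (destruct Hv; lia).
    assert (Hin : i <> X0 -> forall i', valid rt r j i')
      by (intros; eapply valid_inner; eauto).
    rewrite slab_cpos in H by lia.
    assert (Hsame : forall i' t', valid rt r j i' ->
      move (cpos rt r j i t) d = cpos rt r j i' t' -> cell_at rt r j i' t' = l ->
      in_strip (move (cpos rt r j i t) d) /\ slab (move (cpos rt r j i t) d) = l).
    { intros i' t' Hv' -> E. rewrite slab_cpos by lia. split; auto.
      now apply in_strip_cpos. }
    unfold cell_at in H.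
    destruct i; [|specialize (Hin ltac:(discriminate))..]; destruct t;
      simpl in H; unfold on, blank, mark in H.
    + left. destruct d; try discriminate. injection H as <-.
      apply (Hsame X0 Y1); [auto | same_place | reflexivity].
    + left. destruct d; try discriminate. injection H as <-.
      apply (Hsame X0 Y2); [auto | same_place | reflexivity].
    + left. destruct (last_cell rt j) eqn:Hl.
      * destruct d; try discriminate. destruct rt; simpl in Hl; apply Z.eqb_eq in Hl; subst j.
        -- rewrite carry_last in H by lia. simpl in H.
           destruct (Z.eqb_spec r (M - 1)); [discriminate|]. injection H as <-.
           replace (move (cpos true r k X0 Y2) DN) with (cpos false (r + 1) k X0 Y0)
             by (simpl; f_equal; lia).
           rewrite slab_cpos by lia. split; [|reflexivity].
           apply in_strip_cpos. repeat split; auto; lia.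
        -- injection H as <-.
           replace (move (cpos false r 0 X0 Y2) DN) with (cpos true r 0 X0 Y0)
             by (simpl; f_equal; lia).
           rewrite slab_cpos by lia. split.
           ++ apply in_strip_cpos. repeat split; auto; lia.
           ++ unfold cell_at. now rewrite carry_first.
      * assert (Hv' : valid rt r j X1).
        { destruct Hv as (_ & Hj & _). repeat split; try lia. congruence. }
        apply (Hsame X1 Y2); [auto | |]; destruct rt, d; try discriminate; simpl in H;
          injection H as <-; try reflexivity; simpl; f_equal; lia.
    + left. destruct (bit rt r j) eqn:Hb; [|discriminate].
      apply (Hsame X2 Y0); [auto | |]; destruct rt, d; try discriminate; simpl in H;
          injection H as <-; try (simpl; f_equal; lia); unfold cell_at; now rewrite Hb.
    + destruct d; try discriminate. injection H as <-.
      destruct (bit rt r j) eqn:Hb; [left | right].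
      * apply (Hsame X1 Y0); [auto | same_place |]. unfold cell_at; now rewrite Hb.
      * replace (move (cpos rt r j X1 Y1) DS) with (cpos rt r j X1 Y0)
          by (destruct rt; simpl; f_equal; lia).
        destruct (below_reader rt r j (Hin X1)) as (H1 & _ & H2 & _).
        rewrite Hb in H2. split; [exact H1|].
        split; [apply below_reader_before; auto | split; [exact H2 | reflexivity]].
    + left. apply (Hsame X2 Y2); [auto | |]; destruct rt, d; try discriminate; simpl in H;
          injection H as <-; try reflexivity; simpl; f_equal; lia.
    + left. destruct (bit rt r j) eqn:Hb; simpl in H.
      * apply (Hsame X3 Y0); [auto | |]; destruct rt, d; try discriminate; simpl in H;
          injection H as <-; try (simpl; f_equal; lia); unfold cell_at; now rewrite Hb.
      * destruct (dir_eqb_spec (bwd rt) d) as [<-|Hd].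
        -- apply (Hsame X1 Y0); [auto | same_place |].
           destruct rt; simpl in H; injection H as <-; unfold cell_at; now rewrite Hb.
        -- apply (Hsame X3 Y0); [auto | |]; destruct rt, d; try discriminate; simpl in H;
             injection H as <-; try (simpl; f_equal; lia); unfold cell_at; now rewrite Hb.
    + destruct (dir_eqb_spec (bwd rt) d) as [<-|Hd].
      * left. apply (Hsame X1 Y1); [auto | same_place |].
        destruct rt; simpl in H; injection H as <-; reflexivity.
      * destruct d; try discriminate. injection H as <-.
        destruct (bit rt r j) eqn:Hb; [right | left].
        -- replace (move (cpos rt r j X2 Y1) DS) with (cpos rt r j X2 Y0)
             by (destruct rt; simpl; f_equal; lia).
           destruct (below_reader rt r j (Hin X1)) as (_ & H1 & _ & H2).
           rewrite Hb in H2. split; [exact H1|].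
        split; [apply below_reader_before; auto | split; [exact H2 | reflexivity]].
        -- apply (Hsame X2 Y0); [auto | same_place |]. unfold cell_at; now rewrite Hb.
    + left. destruct d; try discriminate. injection H as <-.
      apply (Hsame X2 Y1); [auto | same_place | reflexivity].
    + left. destruct d; try discriminate. injection H as <-.
      apply (Hsame X3 Y1); [auto | same_place | reflexivity].
    + left. destruct d; try discriminate. injection H as <-.
      apply (Hsame X3 Y2); [auto | same_place | reflexivity].
    + left. apply (Hsame X4 Y2); [auto | |]; destruct rt, d; try discriminate; simpl in H;
        try (destruct (xorb (bit _ r j) _); discriminate);
        injection H as <-; try reflexivity; simpl; f_equal; lia.
    + left. destruct (first_cell rt (next rt j)) eqn:Hf; [destruct rt, d; discriminate|].
      assert (E : d = fwd rt /\ l = Cell rt (next rt j) X0 Y0 (carry rt r j && bit rt r j) false)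
        by (destruct rt, d; try discriminate; simpl in H; injection H as <-; auto).
      destruct E as [-> ->].
      replace (move (cpos rt r j X4 Y0) (fwd rt)) with (cpos rt r (next rt j) X0 Y0)
        by (destruct rt; simpl; f_equal; lia).
      rewrite slab_cpos by lia. split.
      * apply in_strip_cpos. apply (valid_next rt r j X4); auto.
        now apply (valid_inner_last rt r j X4).
      * unfold cell_at. rewrite carry_next by (destruct Hv; lia). reflexivity.
    + left. destruct d; try discriminate. injection H as <-.
      apply (Hsame X4 Y0); [auto | same_place | reflexivity].
    + left. destruct d; try discriminate.
      * simpl in H. destruct (negb (xorb (bit rt r j) (carry rt r j))); discriminate.
      * injection H as <-.
        apply (Hsame X4 Y1); [auto | same_place | reflexivity].
Qed.

Lemma semit_exit (q : position) (d : dir) : in_strip q ->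
  sfaces (slab q) d = Emit None -> q = exit /\ d = DN.
Proof.
  intros Hq H. apply in_strip_cases in Hq.
  destruct Hq as [(u & -> & Hu)|(rt & r & j & i & t & -> & Hv)].
  - rewrite slab_init in H. simpl in H. unfold on, mark, blank in H.
    destruct d; simpl in H; try discriminate.
    + destruct (u mod 5 =? 3); [destruct (Z.testbit (value 0) (u / 5)); discriminate|].
      destruct (u mod 5 =? 4); [destruct (Z.testbit (value 0) (u / 5)); discriminate|].
      destruct (u =? 5 * k); discriminate.
    + destruct ((0 <=? u) && (u <? 5 * k)); discriminate.
  - assert (Hr : 0 <= r < M) by (destruct Hv; lia).
    rewrite slab_cpos in H by lia. unfold cell_at in H.
    destruct i, t; simpl in H; unfold on, blank, mark in H;
      repeat match type of H with
      | context [xorb ?x ?y] => destruct (xorb x y)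
      | context [if bit ?x ?y ?z then _ else _] => destruct (bit x y z)
      | context [if first_cell ?x ?y then _ else _] => destruct (first_cell x y)
      end;
      try (destruct rt, d; discriminate).
    destruct (last_cell rt j) eqn:Hl; [|destruct rt, d; discriminate].
    destruct rt, d; try discriminate. apply Z.eqb_eq in Hl. subst j.
    rewrite carry_last in H by lia. simpl in H.
    destruct (Z.eqb_spec r (M - 1)) as [->|]; [|discriminate].
    split; auto. apply row_end_exit.
Qed.

Lemma sfaces_exit : sfaces (slab exit) DN = Emit None.
Proof.
  rewrite <- row_end_exit. unfold row_end, nth_cell.
  rewrite slab_cpos by lia. unfold cell_at. rewrite carry_last by lia. simpl.
  now rewrite !Z.eqb_refl.
Qed.

(** In the layout, only the reading tile that fits the bit has a repelling lower side, and it fits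
    because the tile below it does not repel. *)
Lemma srepel (p : position) : in_strip p -> sfaces (slab p) DS = Repel ->
  in_strip (move p DS) /\ sfaces (slab (move p DS)) DN <> Repel.
Proof.
  intros Hp H. apply in_strip_cases in Hp.
  destruct Hp as [(u & -> & Hu)|(rt & r & j & i & t & -> & Hv)]; [discriminate|].
  assert (Hr : 0 <= r < M) by (destruct Hv; lia).
  rewrite slab_cpos in H by lia. unfold cell_at in H.
  assert (Hin : i <> X0 -> valid rt r j X1)
    by (intros; eapply valid_inner; eauto).
  destruct i, t; try specialize (Hin ltac:(discriminate)); simpl in H;
    try match type of H with context [bit rt r j] => destruct (bit rt r j) eqn:Hb end;
    try (destruct rt; discriminate).
  - destruct (last_cell rt j); destruct rt; discriminate.
  - destruct (below_reader rt r j Hin) as (H1 & _ & H2 & _).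
    split; auto. now rewrite H2, Hb.
  - destruct (below_reader rt r j Hin) as (_ & H1 & _ & H2).
    split; auto. now rewrite H2, Hb.
Qed.

End Strip.

(** * The pinwheel *)

Lemma before_trans (B : blueprint) (p q s : position) :
  before B p q -> before B q s -> before B p s.
Proof. intros H1 H2. induction H2; auto. eapply before_step; eauto. Qed.

(** [Tag h l] is the label [l] of the strip that grows in direction [h]. *)
Inductive plabel : Type := Fill | Tag (h : dir) (l : slabel).

(** The compass direction of what a walker heading [h] calls [d], where [DN] is
    straight ahead and [DE] to the right. *)
Definition rot (h d : dir) : dir :=
  match h with
  | DN => d
  | DW => match d with DN => DW | DE => DN | DS => DE | DW => DS end
  | DS => opp d
  | DE => match d with DN => DE | DE => DS | DS => DW | DW => DN end
  end.

Definition unrot (h d : dir) : dir :=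
  rot (match h with DW => DE | DE => DW | _ => h end) d.

Definition left_of (h : dir) : dir := rot h DW.

Lemma unrot_rot (h d : dir) : unrot h (rot h d) = d.
Proof. now destruct h, d. Qed.

Lemma rot_unrot (h d : dir) : rot h (unrot h d) = d.
Proof. now destruct h, d. Qed.

Lemma rot_opp (h d : dir) : rot h (opp d) = opp (rot h d).
Proof. now destruct h, d. Qed.

Lemma unrot_opp (h d : dir) : unrot h (opp d) = opp (unrot h d).
Proof. now destruct h, d. Qed.

(** * Injective numbering of the labels *)

Definition Z_code (z : Z) : nat := Z.to_nat (if z <? 0 then -2 * z - 1 else 2 * z).
Definition bool_code (b : bool) : nat := if b then 1 else 0.
Definition dir_code (d : dir) : nat :=
  match d with DN => 0 | DE => 1 | DS => 2 | DW => 3 end.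

Definition slabel_code (l : slabel) : nat :=
  match l with
  | Init u => to_nat (O, Z_code u)
  | Cell rt j i t c b =>
      to_nat (S (bool_code rt), to_nat (Z_code j, to_nat (Z.to_nat (col_Z i),
        to_nat (Z.to_nat (row_Z t), to_nat (bool_code c, bool_code b)))))
  end.

Definition plabel_code (l : plabel) : nat :=
  match l with
  | Fill => O
  | Tag h l => S (to_nat (dir_code h, slabel_code l))
  end.

Lemma Z_code_inj (x y : Z) : Z_code x = Z_code y -> x = y.
Proof.
  unfold Z_code. destruct (Z.ltb_spec x 0), (Z.ltb_spec y 0); lia.
Qed.

Lemma to_nat_pair_inj (a b c d : nat) : to_nat (a, b) = to_nat (c, d) -> a = c /\ b = d.
Proof. intros H. apply to_nat_inj in H. now injection H. Qed.

Lemma slabel_code_inj (l l' : slabel) : slabel_code l = slabel_code l' -> l = l'.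
Proof.
  destruct l as [u|rt j i t c b], l' as [u'|rt' j' i' t' c' b'];
    unfold slabel_code; intros H; apply to_nat_pair_inj in H; destruct H as [H1 H].
  - f_equal. now apply Z_code_inj.
  - discriminate.
  - discriminate.
  - apply to_nat_pair_inj in H. destruct H as [H2 H].
    apply to_nat_pair_inj in H. destruct H as [H3 H].
    apply to_nat_pair_inj in H. destruct H as [H4 H].
    apply to_nat_pair_inj in H. destruct H as [H5 H].
    apply Z_code_inj in H2.
    assert (rt = rt') by now destruct rt, rt'.
    assert (i = i') by now destruct i, i'.
    assert (t = t') by now destruct t, t'.
    assert (c = c') by now destruct c, c'.
    assert (b = b') by now destruct b, b'.
    congruence.
Qed.

Lemma plabel_code_inj (l l' : plabel) : plabel_code l = plabel_code l' -> l = l'.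
Proof.
  destruct l as [|h l], l' as [|h' l']; unfold plabel_code; try easy.
  intros H. injection H as H. apply to_nat_pair_inj in H. destruct H as [H1 H2].
  apply slabel_code_inj in H2. assert (h = h') by now destruct h, h'. congruence.
Qed.

Lemma plabel_eq_dec (l l' : plabel) : {l = l'} + {l <> l'}.
Proof.
  destruct (Nat.eq_dec (plabel_code l) (plabel_code l')) as [E|E].
  - left. now apply plabel_code_inj.
  - right. congruence.
Qed.

Definition Z_range (n : Z) : list Z := map Z.of_nat (seq 0 (Z.to_nat n)).

Lemma in_Z_range (n z : Z) : 0 <= z < n -> In z (Z_range n).
Proof.
  intros H. unfold Z_range. apply in_map_iff. exists (Z.to_nat z).
  split; [lia|]. apply in_seq. lia.
Qed.

Lemma length_Z_range (n : Z) : length (Z_range n) = Z.to_nat n.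
Proof. unfold Z_range. now rewrite length_map, length_seq. Qed.

Section Pinwheel.
Context (k M : Z).

Definition size : Z := 5 * k + 6 * M + 2.

(** The strips [DN], [DW], [DS], [DE] lie along the right, upper, left and lower side of the square,
    and they grow in this order. The left column of each one faces the inside. *)
Definition emb (h : dir) (p : position) : position :=
  let (u, v) := p in
  match h with
  | DN => (6 * M + 1 + u, v)
  | DW => (size - 1 - v, 6 * M + 1 + u)
  | DS => (5 * k - u, size - 1 - v)
  | DE => (v, 5 * k - u)
  end.

Definition unemb (h : dir) (p : position) : position :=
  let (x, y) := p in
  match h with
  | DN => (x - 6 * M - 1, y)
  | DW => (y - 6 * M - 1, size - 1 - x)
  | DS => (5 * k - x, size - 1 - y)
  | DE => (5 * k - y, x)
  end.

Lemma emb_unemb (h : dir) (p : position) : emb h (unemb h p) = p.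
Proof. destruct p, h; simpl; f_equal; lia. Qed.

Lemma unemb_emb (h : dir) (p : position) : unemb h (emb h p) = p.
Proof. destruct p, h; simpl; f_equal; lia. Qed.

Lemma emb_move (h d : dir) (p : position) : emb h (move p d) = move (emb h p) (rot h d).
Proof. destruct p, h, d; simpl; f_equal; lia. Qed.

(** Beyond the top row of a strip comes the left column of the next one, and beyond the exit, at
    [u = 5 * k], its origin. *)
Lemma emb_top (h : dir) (u : Z) : emb h (u, 6 * M + 1) = emb (left_of h) (0, 5 * k - u).
Proof. destruct h; unfold emb, size; simpl; f_equal; lia. Qed.

Definition in_stripb (p : position) : bool :=
  (0 <=? fst p) && (fst p <=? 5 * k) && (0 <=? snd p) && (snd p <=? 6 * M).

Lemma in_stripb_spec (p : position) : reflect (in_strip k M p) (in_stripb p).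
Proof.
  unfold in_stripb, in_strip. apply iff_reflect. rewrite !andb_true_iff, !Z.leb_le. lia.
Qed.

Definition center (p : position) : Prop :=
  5 * k < fst p <= 6 * M /\ 5 * k < snd p <= 6 * M.

Definition centerb (p : position) : bool :=
  (5 * k <? fst p) && (fst p <=? 6 * M) && (5 * k <? snd p) && (snd p <=? 6 * M).

Lemma centerb_spec (p : position) : reflect (center p) (centerb p).
Proof.
  unfold centerb, center. apply iff_reflect.
  rewrite !andb_true_iff, !Z.leb_le, !Z.ltb_lt. lia.
Qed.

Definition playout (p : position) : option plabel :=
  if in_stripb (unemb DN p) then Some (Tag DN (slab k M (unemb DN p)))
  else if in_stripb (unemb DW p) then Some (Tag DW (slab k M (unemb DW p)))
  else if in_stripb (unemb DS p) then Some (Tag DS (slab k M (unemb DS p)))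
  else if in_stripb (unemb DE p) then Some (Tag DE (slab k M (unemb DE p)))
  else if centerb p then Some Fill else None.

(** Whether a tile may emit the filler has to be read off its label. [Init 0] is left out: in the
    last strip the third strip lies above it. *)
Definition left_column (l : slabel) : bool :=
  match l with Cell _ j X0 _ _ _ => j =? 0 | _ => false end.

Definition parrival (l : plabel) : dir :=
  match l with Fill => DN | Tag h l => rot h (sarrival k l) end.

(** The exit of a strip emits the origin of the next one, except for the strip [DE], whose exit
    touches the root. The upper side of that strip consists of left sides in its own frame, and
    there the filler leaves. *)
Definition pfaces (l : plabel) (d : dir) : face plabel :=
  match l with
  | Fill => on DN (Emit Fill) blank d
  | Tag h l =>
      match sfaces k M l (unrot h d) with
      | Emit (Some l') => Emit (Tag h l')
      | Emit None =>
          match h with DE => Blank | _ => Emit (Tag (left_of h) (Init 0)) end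
      | Repel => Repel
      | Blank =>
          match h, d with
          | DE, DN => if left_column l then Emit Fill else Blank
          | _, _ => Blank
          end
      end
  end.

Definition slabels : list slabel :=
  map Init (Z_range (5 * k + 1)) ++
  map (fun '(rt, (j, (i, (t, (c, b))))) => Cell rt j i t c b)
    (list_prod (true :: false :: nil)
      (list_prod (Z_range (k + 1))
        (list_prod (X0 :: X1 :: X2 :: X3 :: X4 :: nil)
          (list_prod (Y0 :: Y1 :: Y2 :: nil)
            (list_prod (true :: false :: nil) (true :: false :: nil)))))).

Definition plabels : list plabel :=
  Fill :: flat_map (fun h => map (Tag h) slabels) (DN :: DE :: DS :: DW :: nil).

Definition pinwheel : blueprint := {|
  label := plabel;
  code := plabel_code;
  arrival := parrival;
  faces := pfaces;
  labels := nodup plabel_eq_dec plabels;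
  layout := playout;
  root := emb DN (0, 0)
|}.

(** Each strip has [5 * k + 1] labels for its initial row and [120 * (k + 1)] for its cells; the
    filler adds one. *)
Lemma length_plabels : 0 <= k -> Z.of_nat (length plabels) = 500 * k + 485.
Proof.
  intros Hk. unfold plabels, slabels.
  cbn [flat_map length]. rewrite app_nil_r.
  rewrite !length_app, !length_map, !length_app, !length_map, !length_prod, !length_Z_range.
  cbn [length]. lia.
Qed.

Context (Hk : 1 <= k) (HM : 1 <= M <= 2 ^ k) (HkM : 5 * k <= 6 * M).

(** The strips are disjoint, so the order of the tests in [playout] is immaterial. *)
Lemma playout_emb (h : dir) (p : position) : in_strip k M p ->
  playout (emb h p) = Some (Tag h (slab k M p)).
Proof.
  intros Hp. unfold playout.
  assert (Hself : in_stripb (unemb h (emb h p)) = true)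
    by (rewrite unemb_emb; now destruct (in_stripb_spec p)).
  assert (Hother : forall h', h' <> h -> in_stripb (unemb h' (emb h p)) = false).
  { intros h' Hne. destruct (in_stripb_spec (unemb h' (emb h p))) as [H|]; auto.
    exfalso. destruct p as [u v]. unfold in_strip, size in *.
    destruct h, h'; try easy; simpl in *; unfold size in *; lia. }
  destruct h; rewrite ?(Hother DN), ?(Hother DW), ?(Hother DS), ?(Hother DE), ?Hself
    by discriminate; now rewrite unemb_emb.
Qed.

Lemma playout_center (p : position) : center p -> playout p = Some Fill.
Proof.
  intros Hp. unfold playout.
  assert (Hother : forall h, in_stripb (unemb h p) = false).
  { intros h. destruct (in_stripb_spec (unemb h p)) as [H|]; auto.
    exfalso. destruct p as [x y]. unfold in_strip, center in *.
    destruct h; simpl in *; unfold size in *; lia. }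
  rewrite !Hother. now destruct (centerb_spec p).
Qed.

Lemma playout_cases (q : position) (l : plabel) : playout q = Some l ->
  (exists h p, in_strip k M p /\ q = emb h p /\ l = Tag h (slab k M p)) \/
  (center q /\ l = Fill).
Proof.
  unfold playout. intros H.
  destruct (in_stripb_spec (unemb DN q)) as [Hs|_].
  { injection H as <-. left. exists DN, (unemb DN q). now rewrite emb_unemb. }
  destruct (in_stripb_spec (unemb DW q)) as [Hs|_].
  { injection H as <-. left. exists DW, (unemb DW q). now rewrite emb_unemb. }
  destruct (in_stripb_spec (unemb DS q)) as [Hs|_].
  { injection H as <-. left. exists DS, (unemb DS q). now rewrite emb_unemb. }
  destruct (in_stripb_spec (unemb DE q)) as [Hs|_].
  { injection H as <-. left. exists DE, (unemb DE q). now rewrite emb_unemb. }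
  destruct (centerb_spec q) as [Hc|_]; [|discriminate].
  injection H as <-. auto.
Qed.

Lemma playout_square (q : position) : playout q <> None <-> square size q.
Proof.
  split.
  - destruct (playout q) as [l|] eqn:H; [intros _|easy].
    apply playout_cases in H. destruct H as [(h & [u v] & Hp & -> & _)|[Hc _]].
    + unfold in_strip in Hp; simpl in Hp.
      destruct h; unfold square; simpl; unfold size; lia.
    + unfold center, square, size in *. lia.
  - intros Hq. unfold playout.
    destruct (in_stripb_spec (unemb DN q)) as [|H1]; [easy|].
    destruct (in_stripb_spec (unemb DW q)) as [|H2]; [easy|].
    destruct (in_stripb_spec (unemb DS q)) as [|H3]; [easy|].
    destruct (in_stripb_spec (unemb DE q)) as [|H4]; [easy|].
    destruct (centerb_spec q) as [|H5]; [easy|].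
    exfalso. destruct q as [x y]. unfold in_strip, center, square, size in *.
    simpl in *. unfold size in *. lia.
Qed.

Lemma emb_root (h : dir) (p : position) : in_strip k M p ->
  emb h p = emb DN (0, 0) -> h = DN /\ p = (0, 0).
Proof.
  intros Hp E. assert (h = DN).
  { pose proof (playout_emb h p Hp) as H1. rewrite E, playout_emb in H1.
    - now injection H1.
    - unfold in_strip; simpl; lia. }
  subst h. split; auto. apply (f_equal (unemb DN)) in E. now rewrite !unemb_emb in E.
Qed.

(** * The order of growth across the strips *)

Lemma before_sbefore (h : dir) (p q : position) : sbefore k M p q ->
  before pinwheel (emb h p) (emb h q).
Proof.
  intros H. induction H as [|q Hq Hq0 _ IH]; [apply before_refl|].
  apply (before_step pinwheel _ (emb h q) (Tag h (slab k M q))).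
  - now apply playout_emb.
  - intros E. now apply emb_root in E.
  - simpl. now rewrite <- rot_opp, <- emb_move.
Qed.

Lemma before_corner (h : dir) : h <> DE ->
  before pinwheel (emb h (exit k M)) (emb (left_of h) (0, 0)).
Proof.
  intros Hh.
  apply (before_step pinwheel _ (emb (left_of h) (0, 0)) (Tag (left_of h) (Init 0))).
  - apply (playout_emb (left_of h) (0, 0)). unfold in_strip; simpl; lia.
  - intros E. apply emb_root in E; [|unfold in_strip; simpl; lia].
    destruct E as [E _]. now destruct h.
  - replace (move (emb (left_of h) (0, 0)) (opp (arrival pinwheel (Tag (left_of h) (Init 0)))))
      with (emb h (exit k M)); [apply before_refl|].
    destruct h; unfold emb, exit, size; simpl; unfold size; f_equal; lia.
Qed.

(** The left column and the top row are the borders that filler tiles may run into; they are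
    complete before the next strip starts. *)
Lemma before_next_strip (h : dir) (p q : position) : h <> DE -> in_strip k M p ->
  fst p = 0 \/ snd p = 6 * M -> in_strip k M q ->
  before pinwheel (emb h p) (emb (left_of h) q).
Proof.
  intros Hh Hp Hb Hq.
  eapply before_trans; [apply before_sbefore, boundary_before_exit; eauto|].
  eapply before_trans; [now apply before_corner|].
  apply before_sbefore, origin_before; auto.
Qed.

Lemma in_strip_origin : in_strip k M (0, 0).
Proof. unfold in_strip; simpl; lia. Qed.

Lemma strip_connected (h : dir) (p : position) : in_strip k M p ->
  before pinwheel (emb DN (0, 0)) (emb h p).
Proof.
  intros Hp. pose proof in_strip_origin as H0.
  assert (HW : before pinwheel (emb DN (0, 0)) (emb DW (0, 0)))
    by (apply (before_next_strip DN); simpl; auto; discriminate).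
  assert (HS : before pinwheel (emb DW (0, 0)) (emb DS (0, 0)))
    by (apply (before_next_strip DW); simpl; auto; discriminate).
  assert (HE : before pinwheel (emb DS (0, 0)) (emb DE (0, 0)))
    by (apply (before_next_strip DS); simpl; auto; discriminate).
  eapply before_trans; [|apply before_sbefore, origin_before; eauto].
  destruct h; eauto using before_trans, before_refl.
Qed.

Lemma slab_left_column (v : Z) : 1 <= v <= 6 * M ->
  left_column (slab k M (0, v)) = true /\ sfaces k M (slab k M (0, v)) DW = Blank.
Proof.
  intros Hv. destruct (in_strip_cases k M (0, v)) as
    [(u & E & Hu)|(rt & r & j & i & t & E & (Hr & Hj & Hl))].
  - unfold in_strip; simpl; lia.
  - injection E. lia.
  - rewrite E, slab_cpos by lia.
    assert (j = 0 /\ i = X0) as [-> ->].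
    { apply (f_equal fst) in E. destruct rt; simpl in E, Hl.
      - destruct i; simpl in E; split; lia || auto.
      - destruct (Z.eqb_spec j 0); [now rewrite Hl by auto|].
        destruct i; simpl in E; lia. }
    split; [reflexivity|].
    destruct rt, t; try reflexivity. unfold cell_at, sfaces, last_cell.
    destruct (Z.eqb_spec 0 k); [lia | reflexivity].
Qed.

Lemma left_column_inv (p : position) : in_strip k M p ->
  left_column (slab k M p) = true -> fst p = 0 /\ 1 <= snd p.
Proof.
  intros Hp H. apply in_strip_cases in Hp.
  destruct Hp as [(u & -> & Hu)|(rt & r & j & i & t & -> & (Hr & Hj & Hl))]; [discriminate|].
  rewrite slab_cpos in H by lia. simpl in H.
  destruct i; try discriminate. apply Z.eqb_eq in H. subst j.
  destruct rt, t; simpl; lia.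
Qed.

Lemma parent_fill (p : position) : center p ->
  exists l, playout (move p DS) = Some l /\ pfaces l DN = Emit Fill.
Proof.
  intros Hp. destruct (Z.eq_dec (snd p) (5 * k + 1)) as [E|E].
  - destruct p as [x y]. unfold center in Hp. simpl in *. subst y.
    replace (x, 5 * k + 1 - 1) with (emb DE (0, x)) by (simpl; f_equal; lia).
    eexists. split.
    + apply playout_emb. unfold in_strip; simpl; lia.
    + unfold pfaces. destruct (slab_left_column x) as [H1 H2]; [lia|].
      change (unrot DE DN) with DW. now rewrite H1, H2.
  - exists Fill. split; [|reflexivity]. apply playout_center.
    unfold center in *. simpl. lia.
Qed.

Lemma fill_connected (x y : Z) : center (x, y) ->
  before pinwheel (emb DE (0, x)) (x, y).
Proof.
  intros Hp. pose proof Hp as [Hx Hy]. simpl in Hx, Hy.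
  replace y with (5 * k + 1 + (y - (5 * k + 1))) in * by lia.
  assert (Hn : 0 <= y - (5 * k + 1)) by lia. clear Hy. revert Hn Hp.
  generalize (y - (5 * k + 1)). clear y. intros n Hn. revert n Hn.
  apply (natlike_ind (fun n => center (x, 5 * k + 1 + n) ->
    before pinwheel (emb DE (0, x)) (x, 5 * k + 1 + n))).
  all: assert (Hroot : forall y, center (x, y) -> (x, y) <> root pinwheel)
    by (intros y [_ Hy] E; simpl in E, Hy; injection E; lia).
  - intros Hc. apply (before_step pinwheel _ _ Fill); auto.
    + now apply playout_center.
    + replace (move (x, 5 * k + 1 + 0) (opp (arrival pinwheel Fill))) with (emb DE (0, x))
        by (simpl; f_equal; lia).
      apply before_refl.
  - intros n Hn IH Hc. apply (before_step pinwheel _ _ Fill); auto.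
    + now apply playout_center.
    + replace (move (x, 5 * k + 1 + Z.succ n) (opp (arrival pinwheel Fill)))
        with (x, 5 * k + 1 + n) by (simpl; f_equal; lia).
      apply IH. unfold center in *. simpl in *. lia.
Qed.

Lemma exit_faces_north (l : slabel) (d : dir) : sfaces k M l d = Emit None -> d = DN.
Proof.
  destruct l as [u|rt j i t c b]; simpl; unfold on, blank, mark.
  - destruct d; simpl; auto; try discriminate.
    destruct ((0 <=? u) && (u <? 5 * k)); discriminate.
  - destruct i, t; simpl;
      try (destruct (last_cell k rt j)); try (destruct b);
      try (destruct (first_cell k rt (next rt j)));
      destruct rt, d; simpl; auto; discriminate.
Qed.

Lemma left_column_arrival (l : slabel) : left_column l = true -> sarrival k l <> DE.
Proof.
  destruct l as [|rt j [] t c b]; try discriminate.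
  intros H. apply Z.eqb_eq in H. subst j.
  unfold sarrival, first_cell. destruct t; try discriminate.
  destruct rt; [discriminate|]. now destruct (0 =? k).
Qed.

Lemma in_slabels (p : position) : in_strip k M p -> In (slab k M p) slabels.
Proof.
  intros Hp. apply in_or_app. apply in_strip_cases in Hp.
  destruct Hp as [(u & -> & Hu)|(rt & r & j & i & t & -> & (Hr & Hj & Hl))].
  - left. rewrite slab_init. apply in_map, in_Z_range. lia.
  - right. rewrite slab_cpos by lia. unfold cell_at. apply in_map_iff.
    exists (rt, (j, (i, (t, (carry k M rt r j,
      visited_after_reading i t && bit k M rt r j))))).
    split; [reflexivity|].
    assert (Hbool : forall b, In b (true :: false :: nil)) by (intros []; simpl; auto).
    repeat apply in_prod; auto.
    + apply in_Z_range. lia.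
    + destruct i; simpl; auto 6.
    + destruct t; simpl; auto.
Qed.

Lemma in_plabels (p : position) (l : plabel) : playout p = Some l -> In l plabels.
Proof.
  intros H. apply playout_cases in H. destruct H as [(h & q & Hq & _ & ->)|[_ ->]].
  - right. apply in_flat_map. exists h. split; [destruct h; simpl; auto|].
    now apply in_map, in_slabels.
  - now left.
Qed.

(** * The pinwheel is sound *)

Lemma pinwheel_face_arrival (l : plabel) (d : dir) :
  pfaces l d <> Blank -> parrival l <> opp d.
Proof.
  destruct l as [|h l]; simpl.
  - unfold on, blank. now destruct d.
  - intros H E. apply (f_equal (unrot h)) in E. rewrite unrot_rot, unrot_opp in E.
    destruct (sfaces k M l (unrot h d)) as [| |[l'|]] eqn:Hf.
    + destruct h; try easy. destruct d; try easy.
      destruct (left_column l) eqn:Hc; [|easy].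
      now apply left_column_arrival in Hc.
    + now apply (sface_arrival k M l (unrot h d)); [rewrite Hf|].
    + now apply (sface_arrival k M l (unrot h d)); [rewrite Hf|].
    + now apply (sface_arrival k M l (unrot h d)); [rewrite Hf|].
Qed.

Lemma pinwheel_emit_arrival (l : plabel) (d : dir) (l' : plabel) :
  pfaces l d = Emit l' -> parrival l' = d.
Proof.
  destruct l as [|h l]; simpl.
  - unfold on, blank. destruct d; simpl; try discriminate. now intros [= <-].
  - destruct (sfaces k M l (unrot h d)) as [| |[l''|]] eqn:Hf.
    + destruct h; try discriminate. destruct d; try discriminate.
      destruct (left_column l); [|discriminate]. now intros [= <-].
    + discriminate.
    + intros [= <-]. simpl. apply semit_arrival in Hf. rewrite Hf. apply rot_unrot.
    + apply exit_faces_north in Hf. intros H.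
      rewrite <- (rot_unrot h d), Hf.
      destruct h; try discriminate; injection H as <-; reflexivity.
Qed.

Lemma pinwheel_root_orphan (l : plabel) (d : dir) : pfaces l d <> Emit (Tag DN (Init 0)).
Proof.
  destruct l as [|h l]; simpl.
  - unfold on, blank. now destruct d.
  - destruct (sfaces k M l (unrot h d)) as [| |[l''|]] eqn:Hf.
    + destruct h; try discriminate. destruct d; try discriminate.
      destruct (left_column l); discriminate.
    + discriminate.
    + intros [= -> ->]. simpl in Hf.
      destruct l as [u|rt j i t c b]; simpl in Hf; unfold on, blank, mark in Hf.
      * destruct (unrot DN d); simpl in Hf; try discriminate.
        -- destruct (u mod 5 =? 3); [destruct (Z.testbit (value k M 0) (u / 5)); discriminate|].
           destruct (u mod 5 =? 4); [destruct (Z.testbit (value k M 0) (u / 5)); discriminate|].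
           destruct (u =? 5 * k); discriminate.
        -- destruct (Z.leb_spec 0 u), (u <? 5 * k); try discriminate.
           injection Hf. lia.
      * destruct i, t; simpl in Hf;
          try (destruct (last_cell k rt j)); try (destruct b);
          try (destruct (first_cell k rt (next rt j)));
          destruct rt, c, (unrot DN d); discriminate.
    + destruct h; discriminate.
Qed.

Lemma pinwheel_parent (p : position) (l : plabel) :
  playout p = Some l -> p <> emb DN (0, 0) ->
  exists l', playout (move p (opp (parrival l))) = Some l' /\
             pfaces l' (parrival l) = Emit l.
Proof.
  intros Hl Hp. apply playout_cases in Hl.
  destruct Hl as [(h & q & Hq & -> & ->)|[Hc ->]]; [|now apply parent_fill].
  destruct (classic (q = (0, 0))) as [->|Hq0].
  - rewrite slab_init.
    assert (E : exists h', h' <> DE /\ h = left_of h').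
    { destruct h; [now destruct Hp|exists DS|exists DW|exists DN]; now split. }
    destruct E as (h' & Hh' & ->).
    exists (Tag h' (slab k M (exit k M))).
    assert (Ha : parrival (Tag (left_of h') (Init 0)) = rot h' DN) by now destruct h'.
    rewrite Ha. split.
    + replace (move (emb (left_of h') (0, 0)) (opp (rot h' DN))) with (emb h' (exit k M)).
      * apply playout_emb. unfold in_strip, exit; simpl; lia.
      * destruct h'; unfold exit; simpl; unfold size; f_equal; lia.
    + simpl. rewrite unrot_rot, sfaces_exit by auto. now destruct h'.
  - destruct (sparent k M Hk HM q Hq Hq0) as [H1 H2].
    exists (Tag h (slab k M (move q (opp (sarrival k (slab k M q)))))).
    simpl. split.
    + rewrite <- rot_opp, <- emb_move. now apply playout_emb.
    + now rewrite unrot_rot, H2.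
Qed.

Lemma pinwheel_emission (q : position) (lq : plabel) (d : dir) (l : plabel) :
  playout q = Some lq -> pfaces lq d = Emit l ->
  playout (move q d) = Some l \/
  before pinwheel (move q d) q \/
  exists e lr, before pinwheel (move (move q d) e) q /\
    playout (move (move q d) e) = Some lr /\
    pfaces lr (opp e) = Repel /\ pfaces l e = Repel.
Proof.
  intros Hl Hf. apply playout_cases in Hl.
  destruct Hl as [(h & p & Hp & -> & ->)|[Hc ->]].
  - simpl in Hf. destruct (sfaces k M (slab k M p) (unrot h d)) as [| |[l'|]] eqn:Hs.
    + destruct h; try discriminate. destruct d; try discriminate.
      destruct (left_column (slab k M p)) eqn:Hc; [|discriminate].
      injection Hf as <-. destruct (left_column_inv p Hp Hc) as [Hu Hv].
      destruct p as [u v]. simpl in Hu, Hv. subst u.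
      unfold in_strip in Hp; simpl in Hp.
      destruct (Z_le_gt_dec v (5 * k)).
      * right; left.
        replace (move (emb DE (0, v)) DN) with (emb DS (5 * k - v, 6 * M))
          by (simpl; unfold size; f_equal; lia).
        apply (before_next_strip DS); [discriminate| | |];
          unfold in_strip; simpl; lia.
      * left. apply playout_center. unfold center; simpl; lia.
    + discriminate.
    + injection Hf as <-. rewrite <- (rot_unrot h d), <- emb_move.
      destruct (semit k M Hk HM p (unrot h d) l' Hp Hs)
        as [[H1 <-]|(H1 & H2 & H3 & H4)].
      * left. now apply playout_emb.
      * right; right.
        exists (rot h DS), (Tag h (slab k M (move (move p (unrot h d)) DS))).
        rewrite <- emb_move. repeat split.
        -- now apply before_sbefore.
        -- now apply playout_emb.
        -- unfold pfaces. rewrite unrot_opp, unrot_rot. simpl opp. now rewrite H3.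
        -- simpl. now rewrite unrot_rot, H4.
    + left. apply semit_exit in Hs; auto. destruct Hs as [-> Hd].
      rewrite <- (rot_unrot h d), Hd, <- emb_move. unfold exit. simpl move.
      rewrite emb_top. replace (5 * k - 5 * k) with 0 by lia.
      rewrite playout_emb by apply in_strip_origin.
      destruct h; try discriminate; now injection Hf as <-.
  - simpl in Hf. unfold on, blank in Hf. destruct d; try discriminate.
    injection Hf as <-.
    destruct q as [x y]. pose proof Hc as [Hx Hy]. simpl in Hx, Hy.
    destruct (Z.eq_dec y (6 * M)) as [->|].
    + right; left.
      replace (move (x, 6 * M) DN) with (emb DW (0, size - 1 - x))
        by (simpl; unfold size; f_equal; lia).
      eapply before_trans; [|now apply fill_connected].
      eapply before_trans.
      * apply (before_next_strip DW _ (0, 0)); [discriminate| | |];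
          unfold in_strip, size; simpl; lia.
      * apply (before_next_strip DS); [discriminate| | |];
          unfold in_strip; simpl; lia.
    + left. apply playout_center. unfold center; simpl; lia.
Qed.

(** Two repelling sides could meet only vertically inside one strip, which [srepel] excludes, or
    where a top row touches the left column of the next strip, whose left sides never repel. *)
Lemma pinwheel_repulsion (q : position) (d : dir) (l l' : plabel) :
  playout q = Some l -> playout (move q d) = Some l' ->
  pfaces l d = Repel -> pfaces l' (opp d) = Repel -> False.
Proof.
  assert (Hrep : forall h sl e, pfaces (Tag h sl) e = Repel -> sfaces k M sl (unrot h e) = Repel).
  { intros h sl e. simpl. destruct (sfaces k M sl (unrot h e)) as [| |[]]; auto;
      destruct h; try discriminate; destruct e; try discriminate;
      destruct (left_column sl); discriminate. }
  intros Hl Hl' Hf Hf'. apply playout_cases in Hl.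
  destruct Hl as [(h & p & Hp & -> & ->)|[_ ->]].
  2:{ simpl in Hf. unfold on, blank in Hf. now destruct d. }
  apply Hrep in Hf.
  rewrite <- (rot_unrot h d), <- emb_move in Hl'.
  rewrite <- (rot_unrot h d), <- rot_opp in Hf'.
  destruct (unrot h d) eqn:Hd.
  - destruct p as [u v]. unfold in_strip in Hp; simpl in Hp.
    destruct (Z.eq_dec v (6 * M)) as [->|].
    + simpl move in Hl'. rewrite emb_top, playout_emb in Hl'
        by (unfold in_strip; simpl; lia).
      injection Hl' as <-. apply Hrep in Hf'.
      apply sface_horizontal in Hf'; auto. destruct h; auto.
    + rewrite playout_emb in Hl' by (unfold in_strip; simpl; lia).
      assert (l' = Tag h (slab k M (move (u, v) DN))) as -> by congruence.
      apply Hrep in Hf'. rewrite unrot_rot in Hf'. simpl opp in Hf'.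
      apply srepel in Hf'; auto; [|unfold in_strip; simpl; lia].
      destruct Hf' as [_ Hf']. apply Hf'.
      change DS with (opp DN). now rewrite move_opp.
  - apply sface_horizontal in Hf; auto.
  - apply srepel in Hf; auto. destruct Hf as [H1 H2].
    rewrite playout_emb in Hl' by auto. injection Hl' as <-.
    apply Hrep in Hf'. now rewrite unrot_rot in Hf'.
  - apply sface_horizontal in Hf; auto.
Qed.

Lemma pinwheel_sound : sound pinwheel.
Proof.
  pose proof in_strip_origin as H0.
  split.
  - apply plabel_code_inj.
  - intros p l H. apply nodup_In. now apply (in_plabels p).
  - exists (list_prod (Z_range size) (Z_range size)). intros [x y] l H.
    assert (Hs : square size (x, y)) by (apply playout_square; simpl in H; congruence).
    destruct Hs. apply in_prod; now apply in_Z_range.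
  - change (playout (emb DN (0, 0)) <> None). now rewrite playout_emb.
  - intros l d l0 H. change (playout (emb DN (0, 0)) = Some l0) in H.
    rewrite playout_emb in H by auto. injection H as <-. apply pinwheel_root_orphan.
  - apply pinwheel_face_arrival.
  - apply pinwheel_emit_arrival.
  - apply pinwheel_parent.
  - apply pinwheel_emission.
  - apply pinwheel_repulsion.
  - intros q l H. apply playout_cases in H.
    destruct H as [(h & p & Hp & -> & ->)|[Hc ->]].
    + now apply strip_connected.
    + destruct q as [x y]. eapply before_trans; [|now apply fill_connected].
      apply strip_connected. unfold center, in_strip in *. simpl in *. lia.
Qed.

End Pinwheel.

(** * Squares *)

Lemma blueprint_prgTAS (B : blueprint) (X : position -> Prop) : sound B ->
  NoDup (labels B) ->
  (exists l d, In l (labels B) /\ faces B l d = Repel) ->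
  (forall q, layout B q <> None <-> X q) ->
  exists (T : list tile) (s : tile) (p0 : position),
    prg_tileset T s /\ length T = length (labels B) /\
    forall m : Z, 1 <= m -> directed T m p0 s /\ strictly_self_assembles T m p0 s X.
Proof.
  intros HB Hnd (l & d & Hl & Hd) HX.
  exists (map (tile_of B) (labels B)), (seed_tile B), (root B).
  split; [split; [|split]|split].
  - apply FinFun.Injective_map_NoDup; auto. intros a b. now apply tile_of_inj.
  - unfold seed_tile. pose proof (rooted B HB).
    destruct (layout B (root B)) as [l0|] eqn:E; [|easy].
    apply in_map. now apply (listed B HB (root B)).
  - exists (tile_of B l). split; [now apply in_map|].
    assert (H : tile_side (tile_of B l) d = NegG)
      by (rewrite tile_side_of, side_glue_face, Hd; congruence).
    unfold uses_neg. destruct d; simpl in H |- *; auto.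
  - now rewrite length_map.
  - intros m Hm. now apply blueprint_assembles.
Qed.

(** * Small squares *)

Section Comb.
Context (n : Z).

Definition pos_code (p : position) : nat := to_nat (Z_code (fst p), Z_code (snd p)).

Lemma pos_code_inj (p q : position) : pos_code p = pos_code q -> p = q.
Proof.
  destruct p, q. unfold pos_code. intros H. apply to_nat_pair_inj in H.
  destruct H as [H1 H2]. apply Z_code_inj in H1, H2. simpl in *. congruence.
Qed.

Lemma pos_eq_dec (p q : position) : {p = q} + {p <> q}.
Proof. decide equality; apply Z.eq_dec. Qed.

(** The lower bounds on [x] and [y] concern labels outside the square: without them [(-1, y)] would
    emit a tile of column 0 sideways, and [(0, -1)] would emit the root. *)
Definition comb_faces (p : position) (d : dir) : face position :=
  let (x, y) := p in
  match d with
  | DN => if (x =? 0) && (0 <=? y) && (y + 1 <? n) then Emit (0, y + 1) else Blank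
  | DE => if (0 <=? x) && (x + 1 <? n) then Emit (x + 1, y) else Blank
  | DS => Blank
  | DW => if (x =? 0) && (y =? 0) then Repel else Blank
  end.

Definition squareb (p : position) : bool :=
  (0 <=? fst p) && (fst p <? n) && (0 <=? snd p) && (snd p <? n).

Lemma squareb_spec (p : position) : reflect (square n p) (squareb p).
Proof.
  unfold squareb, square. apply iff_reflect.
  rewrite !andb_true_iff, !Z.leb_le, !Z.ltb_lt. lia.
Qed.

(** The repelling side of the corner tile faces no tile: it is there only because
    the definition of a prgTAS asks for the negative glue to occur. *)
Definition comb : blueprint := {|
  label := position;
  code := pos_code;
  arrival := fun p => if fst p =? 0 then DN else DE;
  faces := comb_faces;
  labels := nodup pos_eq_dec (list_prod (Z_range n) (Z_range n));
  layout := fun p => if squareb p then Some p else None;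
  root := (0, 0)
|}.

Context (Hn : 1 <= n).

Lemma comb_layout (p q : position) : layout comb p = Some q <-> square n p /\ q = p.
Proof.
  simpl. destruct (squareb_spec p); split; try easy.
  - now intros [= ->].
  - now intros [_ ->].
Qed.

Lemma comb_connected_column (y : Z) : 0 <= y -> y < n -> before comb (0, 0) (0, y).
Proof.
  revert y. apply (natlike_ind (fun y => y < n -> before comb (0, 0) (0, y))).
  - intros _. apply before_refl.
  - intros y Hy IH Hlt. apply (before_step comb _ _ (0, Z.succ y)).
    + apply comb_layout. split; [unfold square; simpl; lia | reflexivity].
    + intros E. apply (f_equal snd) in E. change (Z.succ y = 0) in E. lia.
    + simpl. replace (Z.succ y - 1) with y by lia. apply IH. lia.
Qed.

Lemma comb_connected (x y : Z) : 0 <= y < n -> 0 <= x -> x < n -> before comb (0, 0) (x, y).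
Proof.
  intros Hy. revert x. apply (natlike_ind (fun x => x < n -> before comb (0, 0) (x, y))).
  - intros _. now apply comb_connected_column.
  - intros x Hx IH Hlt. apply (before_step comb _ _ (Z.succ x, y)).
    + apply comb_layout. split; [unfold square; simpl; lia | reflexivity].
    + intros E. apply (f_equal fst) in E. change (Z.succ x = 0) in E. lia.
    + cbn [arrival comb fst]. destruct (Z.eqb_spec (Z.succ x) 0); [lia|].
      simpl. replace (Z.succ x - 1) with x by lia. apply IH. lia.
Qed.

Lemma comb_sound : sound comb.
Proof.
  split.
  - apply pos_code_inj.
  - intros p l H. apply comb_layout in H. destruct H as [[H1 H2] ->]. apply nodup_In.
    destruct p. apply in_prod; now apply in_Z_range.
  - exists (list_prod (Z_range n) (Z_range n)). intros p l H.
    apply comb_layout in H. destruct H as [[H1 H2] _].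
    destruct p. apply in_prod; now apply in_Z_range.
  - assert (H : layout comb (root comb) = Some (0, 0))
      by (apply comb_layout; split; [unfold square; simpl; lia | reflexivity]).
    now rewrite H.
  - intros [x y] d l0 H. apply comb_layout in H. destruct H as [_ ->]. simpl.
    destruct d; try easy.
    + destruct (Z.leb_spec 0 y); rewrite ?andb_true_r, ?andb_false_r; simpl; [|easy].
      destruct ((x =? 0) && (y + 1 <? n)); [|easy]. intros [= H1]. lia.
    + destruct (Z.leb_spec 0 x); simpl; [|easy].
      destruct (x + 1 <? n); [|easy]. intros [= H1]. lia.
    + destruct ((x =? 0) && (y =? 0)); easy.
  - intros [x y] d. simpl. destruct d, (Z.eqb_spec x 0); simpl; try easy.
  - intros [x y] d [x' y']. simpl. destruct d; try easy.
    + destruct ((x =? 0) && (0 <=? y) && (y + 1 <? n)); [|easy]. now intros [= <- <-].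
    + destruct (Z.leb_spec 0 x), (x + 1 <? n); try easy. intros [= <- <-].
      destruct (Z.eqb_spec (x + 1) 0); [lia | easy].
    + destruct ((x =? 0) && (y =? 0)); easy.
  - intros [x y] l H Hr. apply comb_layout in H. destruct H as [[H1 H2] ->].
    cbn [arrival comb fst]. cbn [fst snd] in H1, H2.
    destruct (Z.eqb_spec x 0) as [->|Hx].
    + assert (y <> 0) by (intros ->; now apply Hr).
      exists (0, y - 1). split.
      * apply comb_layout. unfold square; simpl. split; [lia | reflexivity].
      * simpl. destruct (Z.leb_spec 0 (y - 1)), (Z.ltb_spec (y - 1 + 1) n); try lia.
        now replace (y - 1 + 1) with y by lia.
    + exists (x - 1, y). split.
      * apply comb_layout. unfold square; simpl. split; [lia | reflexivity].
      * simpl. destruct (Z.leb_spec 0 (x - 1)), (Z.ltb_spec (x - 1 + 1) n); try lia.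
        now replace (x - 1 + 1) with x by lia.
  - intros [x y] lq d l H Hf. left. apply comb_layout in H. destruct H as [[H1 H2] ->].
    apply comb_layout. cbn [fst snd] in H1, H2. simpl in Hf.
    destruct d; try discriminate; simpl.
    + destruct (Z.eqb_spec x 0) as [->|]; [|discriminate].
      destruct (Z.leb_spec 0 y), (Z.ltb_spec (y + 1) n); try discriminate.
      injection Hf as <-. unfold square; simpl. split; [lia | reflexivity].
    + destruct (Z.leb_spec 0 x), (Z.ltb_spec (x + 1) n); try discriminate.
      injection Hf as <-. unfold square; simpl. split; [lia | reflexivity].
    + destruct ((x =? 0) && (y =? 0)); discriminate.
  - intros [x y] d l l' _ _. destruct l as [a b], l' as [a' b'].
    destruct d; simpl; try easy.
    + now destruct ((0 <=? a) && (a + 1 <? n)).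
    + now destruct ((0 <=? a') && (a' + 1 <? n)).
  - intros [x y] l H. apply comb_layout in H. destruct H as [[H1 H2] _].
    now apply comb_connected.
Qed.

End Comb.

Lemma length_nodup_le (A : Type) (dec : forall x y : A, {x = y} + {x <> y}) (l : list A) :
  (length (nodup dec l) <= length l)%nat.
Proof.
  apply NoDup_incl_length; [apply NoDup_nodup|]. intros x. apply nodup_In.
Qed.

Lemma comb_prgTAS (N : nat) : (2 <= N)%nat ->
  exists (T : list tile) (s : tile) (p0 : position),
    prg_tileset T s /\ (length T <= N * N)%nat /\
    forall m : Z, 1 <= m ->
      directed T m p0 s /\ strictly_self_assembles T m p0 s (square (Z.of_nat N)).
Proof.
  intros HN.
  destruct (blueprint_prgTAS (comb (Z.of_nat N)) (square (Z.of_nat N)))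
    as (T & s & p0 & HT & Hlen & H).
  - apply comb_sound. lia.
  - apply NoDup_nodup.
  - exists (0, 0), DW. split; [|reflexivity]. apply nodup_In.
    apply in_prod; apply in_Z_range; lia.
  - intros q. simpl. now destruct (squareb_spec (Z.of_nat N) q).
  - exists T, s, p0. split; [|split]; auto. rewrite Hlen.
    assert (E : length (list_prod (Z_range (Z.of_nat N)) (Z_range (Z.of_nat N))) = (N * N)%nat)
      by (rewrite length_prod, length_Z_range; lia).
    rewrite <- E. apply length_nodup_le.
Qed.

(* Cells have width 5 and a full counting cycle has height 6; since 5 and 6 are
   coprime, a suitable number of bits adjusts the side length modulo 6. *)
Lemma pinwheel_parameters (N : Z) : 256 <= N -> exists k M : Z,
  1 <= k <= Z.log2 N + 6 /\ 1 <= M <= 2 ^ k /\ 5 * k <= 6 * M /\ size k M = N.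
Proof.
  intros HN. set (a := Z.log2 N).
  pose proof (Z.log2_spec N ltac:(lia)) as [Hlo Hhi]. fold a in Hlo, Hhi.
  assert (Ha : 8 <= a) by (change 8 with (Z.log2 256); now apply Z.log2_le_mono).
  (* Since [k <= a + 6], this gives [10 * k + 2 <= N], which is [5 * k <= 6 * M] in disguise. It
     fails for [a = 7], hence the bound 256. *)
  assert (Hpow : 10 * a + 62 <= 2 ^ a).
  { replace a with (8 + (a - 8)) at 2 by lia. rewrite Z.pow_add_r by lia.
    pose proof (Z.pow_gt_lin_r 2 (a - 8) ltac:(lia) ltac:(lia)).
    change (2 ^ 8) with 256. lia. }
  (* Modulo 6, the equation [5 * k + 6 * M + 2 = N] says that [k] is [2 - N]; [e] corrects [a + 1]
     accordingly. Starting from [a + 1] ensures [N < 2 ^ k], whence [M <= 2 ^ k]. *)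
  set (e := (1 - N - a) mod 6). set (k := a + 1 + e).
  pose proof (Z.mod_pos_bound (1 - N - a) 6 ltac:(lia)) as He. fold e in He.
  pose proof (Z.div_mod (1 - N - a) 6 ltac:(lia)) as Hdiv. fold e in Hdiv.
  set (q := (1 - N - a) / 6) in *.
  exists k, (- q - k). unfold size.
  assert (Hpk : 2 ^ Z.succ a <= 2 ^ k) by (apply Z.pow_le_mono_r; lia).
  unfold k in *. repeat split; try lia.
Qed.

Lemma pinwheel_prgTAS (N : nat) : (256 <= N)%nat ->
  exists (T : list tile) (s : tile) (p0 : position),
    prg_tileset T s /\ (length T <= 500 * Nat.log2 N + 3485)%nat /\
    forall m : Z, 1 <= m ->
      directed T m p0 s /\ strictly_self_assembles T m p0 s (square (Z.of_nat N)).
Proof.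
  intros HN.
  destruct (pinwheel_parameters (Z.of_nat N) ltac:(lia)) as (k & M & Hk & HM & HkM & Hsize).
  destruct (blueprint_prgTAS (pinwheel k M) (square (Z.of_nat N)))
    as (T & s & p0 & HT & Hlen & H).
  - apply pinwheel_sound; lia.
  - apply NoDup_nodup.
  - exists (Tag DN (Cell true 0 X1 Y0 false true)), DS. split; [|reflexivity].
    apply nodup_In. right. apply in_flat_map. exists DN. split; [now left|].
    apply in_map, in_or_app. right. apply in_map_iff.
    exists (true, (0, (X1, (Y0, (false, true))))). split; [reflexivity|].
    repeat apply in_prod; simpl; auto. apply in_Z_range. lia.
  - intros q. rewrite <- Hsize. apply playout_square; lia.
  - exists T, s, p0. split; [|split]; auto. rewrite Hlen.
    eapply Nat.le_trans; [exact (length_nodup_le _ plabel_eq_dec (plabels k))|].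
    pose proof (length_plabels k ltac:(lia)) as Hl.
    assert (Hlog : Z.of_nat (Nat.log2 N) = Z.log2 (Z.of_nat N)).
    { symmetry. apply Z.log2_unique; [lia|].
      pose proof (Nat.log2_spec N ltac:(lia)) as [Hlo Hhi].
      rewrite <- Nat2Z.inj_succ, <- !(Nat2Z.inj_pow 2). lia. }
    lia.
Qed.

Lemma log2_le_log2R (N : nat) : (1 <= N)%nat -> (INR (Nat.log2 N) <= log2R (INR N))%R.
Proof.
  intros HN. unfold log2R. pose proof ln_lt_2 as H2.
  apply (Rmult_le_reg_r (ln 2)); [lra|].
  unfold Rdiv. rewrite Rmult_assoc, Rinv_l, Rmult_1_r by lra.
  rewrite <- ln_pow by lra.
  assert (Hpow : (2 ^ Nat.log2 N <= INR N)%R).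
  { change 2%R with (INR 2). rewrite <- pow_INR. apply le_INR.
    apply Nat.log2_spec. lia. }
  assert (Hpos : (0 < 2 ^ Nat.log2 N)%R) by (apply pow_lt; lra).
  destruct Hpow as [Hlt|Heq]; [left; now apply ln_increasing | right; now rewrite Heq].
Qed.

Theorem theorem2 :
  exists C : R, forall N : nat, (2 <= N)%nat ->
    exists (T : list tile) (s : tile) (p0 : position),
      prg_tileset T s /\
      (INR (length T) <= C * log2R (INR N))%R /\
      forall m : Z, (1 <= m)%Z ->
        directed T m p0 s /\
        strictly_self_assembles T m p0 s (square (Z.of_nat N)).
Proof.
  (* Below 256 the [N * N] tile types of the comb are fewer than [256 * 256]; from 256 on,
     [500 * Nat.log2 N + 3485] is far smaller than the bound. In both cases [1 <= Nat.log2 N] is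
     used. *)
  exists (INR (256 * 256)). intros N HN.
  assert (Hone : (1 <= Nat.log2 N)%nat) by (apply (Nat.log2_le_mono 2 N HN)).
  assert (Hbound : forall len : nat, (len <= 256 * 256 * Nat.log2 N)%nat ->
    (INR len <= INR (256 * 256) * log2R (INR N))%R).
  { intros len Hlen. apply le_INR in Hlen. rewrite mult_INR in Hlen.
    eapply Rle_trans; [exact Hlen|].
    apply Rmult_le_compat_l; [apply pos_INR | apply log2_le_log2R; lia]. }
  destruct (le_lt_dec 256 N) as [Hbig|Hsmall].
  - destruct (pinwheel_prgTAS N Hbig) as (T & s & p0 & HT & Hlen & H).
    exists T, s, p0. split; [|split]; auto. apply Hbound. lia.
  - destruct (comb_prgTAS N HN) as (T & s & p0 & HT & Hlen & H).
    exists T, s, p0. split; [|split]; auto. apply Hbound. nia.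
Qed.
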